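(* Let $k,s\in\omega$. Let $\Gamma$ be the class of (locally finite) $k$-colorable perfect graphs and $\Pi$ the problem of proper $(k+s)$-coloring. Then $(\Pi,\Gamma)\in\textnormal{ASI}_c(s)$.
   Context: A graph is perfect if for each of its induced subgraphs, the chromatic number equals the size of the largest clique in that subgraph. All graphs are locally finite. HF denotes the set of hereditarily finite sets. A coloring problem $(\Pi,\Gamma)$ consists of a class $\Gamma$ of (structured) graphs, closed under isomorphism and such that $G\in\Gamma$ iff every connected component of $G$ is in $\Gamma$, and a class $\Pi$ of functions $V(G)\to\textnormal{HF}$ ($G\in\Gamma$), closed under pushforward by isomorphisms and such that $c\in\Pi$ iff its restriction to each component is in $\Pi$. An ASI-$s$ algorithm is a function $\mathcal{A}$ which, on input $(H,<,U_0,\dots,U_s,C)$ where $H$ is a finite graph, $<$ a linear order on $V(H)$, $U_0,\dots,U_s$ a partition of $V(H)$, and $C\subseteq V(H)$, returns a function $C\to\textnormal{HF}$, such that for any isomorphism $\phi$ of such input structures, $\mathcal{A}(\text{input})=\mathcal{A}(\phi(\text{input}))\circ(\phi\upharpoonright C)$. It is computable if it is computable as a function on (canonical HF codes of) its inputs. For a graph $G$ with path metric $\rho_G$ and $r\in\omega$, $G^r$ is the graph on $V(G)$ joining distinct $x,y$ with $\rho_G(x,y)\le r$. An ASI-$s$ witness for $G$ with scale $r$ is a partition $U_0,\dots,U_s$ of $V(G)$ such that every connected component of each $G^r\upharpoonright U_i$ is finite. Given such a witness and a linear order $<$ on $V(G)$, let $\mathcal{C}$ be the disjoint set of all components of all $G^r\upharpoonright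 U_i$, and $\tilde G$ the graph on $\mathcal{C}$ joining $C\neq D$ when $\rho_G(C,D)\le r$. For $n\in\omega$, $\mathcal{A}_n[(G,<,U_0,\dots,U_s)]$ colors each $C\in\mathcal{C}$ by $\mathcal{A}(G\upharpoonright W,<\upharpoonright W,U_0\cap W,\dots,U_s\cap W,C)$, where $W=\bigcup\{D\in\mathcal{C}:\rho_{\tilde G}(C,D)\le n\}$. $(\Pi,\Gamma)\in\textnormal{ASI}_c(s)$ if there are a computable ASI-$s$ algorithm $\mathcal{A}$ and $n,r\in\omega$ such that for every $G\in\Gamma$, every linear order $<$ on $V(G)$ and every ASI-$s$ witness for $G$ with scale $r$, $\mathcal{A}_n[(G,<,U_0,\dots,U_s)]\in\Pi$. *)

(* Defs.v *)
From mathcomp Require Import all_boot.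
From mathcomp Require Import boolp classical_sets functions cardinality.
From mathcomp Require Import zify.

Set Implicit Arguments.
Unset Strict Implicit.
Unset Printing Implicit Defensive.

Local Open Scope classical_set_scope.
Local Open Scope card_scope.

(* The total recursive functions: the least class containing the initial
   functions and closed under composition, primitive recursion and minimisation
   of regular functions (those with a zero for every value of the parameters).
   Since functions are intensional, closure under [=1] is imposed. *)
Inductive recursive : forall k, (k.-tuple nat -> nat) -> Prop :=
| recursive_zero k : recursive (fun _ : k.-tuple nat => 0)
| recursive_succ : recursive (fun v : 1.-tuple nat => (thead v).+1)
| recursive_proj k (i : 'I_k) : recursive (fun v => tnth v i)
| recursive_comp k m (g : m.-tuple nat -> nat) (h : 'I_m -> k.-tuple nat -> nat) :
    recursive g -> (forall i, recursive (h i)) ->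
    recursive (fun v => g [tuple h i v | i < m])
| recursive_prim k (g : k.-tuple nat -> nat) (h : k.+2.-tuple nat -> nat) :
    recursive g -> recursive h ->
    recursive (fun v : k.+1.-tuple nat =>
      nat_rect (fun=> nat) (g [tuple of behead v])
        (fun n a => h [tuple of n :: a :: behead v]) (thead v))
| recursive_min k (g : k.+1.-tuple nat -> nat)
    (reg : forall v : k.-tuple nat, exists n, g [tuple of n :: v] == 0) :
    recursive g -> recursive (fun v => ex_minn (reg v))
| recursive_ext k (f g : k.-tuple nat -> nat) :
    f =1 g -> recursive f -> recursive g.

Definition recursive1 (f : nat -> nat) : Prop :=
  recursive (fun v : 1.-tuple nat => f (thead v)).

(* HF is identified with nat by Ackermann's bijection: the elements of the set
   coded by [a] are the sets coded by the positions of the 1 bits of [a]. *)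
Definition HF := nat.

Definition hf_mem (x a : HF) : bool := odd (a %/ 2 ^ x).

Definition hf_insert (x a : HF) : HF := if hf_mem x a then a else a + 2 ^ x.

Definition hf_set (s : seq HF) : HF := foldr hf_insert 0 s.

Definition hf_pair (x y : HF) : HF := hf_set [:: hf_set [:: x]; hf_set [:: x; y]].

Fixpoint hf_tuple (x : HF) (s : seq HF) : HF :=
  if s is y :: s' then hf_pair x (hf_tuple y s') else x.

(* von Neumann ordinals *)
Fixpoint hf_nat (n : nat) : HF :=
  if n is m.+1 then hf_insert (hf_nat m) (hf_nat m) else 0.

Lemma hf_mem0 a : hf_mem 0 a = odd a.
Proof. by rewrite /hf_mem expn0 divn1. Qed.

Lemma hf_memS x a : hf_mem x.+1 a = hf_mem x a./2.
Proof. by rewrite /hf_mem expnS divnMA divn2. Qed.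

Lemma hf_ext a b : (forall x, hf_mem x a = hf_mem x b) -> a = b.
Proof.
have [n] := ubnP (a + b); elim: n a b => // n IHn a b lt_ab eq_ab.
have [a0|ab0] := posnP (a + b).
  by move/eqP: a0; rewrite addn_eq0 => /andP[/eqP-> /eqP->].
rewrite -[a]odd_double_half -[b]odd_double_half -!hf_mem0 eq_ab.
congr (_ + _.*2); apply: IHn => [|x]; last by rewrite -!hf_memS.
rewrite ltnS in lt_ab; apply: leq_trans lt_ab.
rewrite -[X in _ < X + _]odd_double_half -[X in _ < _ + X]odd_double_half.
move: ab0; rewrite -{1}[a]odd_double_half -{1}[b]odd_double_half.
by case: (odd a); case: (odd b); case: a./2 => [|?]; case: b./2 => [|?] //= _;
  rewrite -?addnn; lia.
Qed.

Lemma hf_mem_insert x y a : hf_mem y (hf_insert x a) = (y == x) || hf_mem y a.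
Proof.
rewrite /hf_insert; case: ifP => [xa|]; first by case: eqP => [->|].
elim: x y a => [|x IHx] [|y] a; rewrite ?hf_mem0 ?hf_memS ?eqSS.
- by rewrite expn0 oddD /= => ->.
- by rewrite expn0 addn1 -uphalfE uphalf_half => -> /=.
- by rewrite oddD expnS oddM addbF.
- move=> xa; rewrite -IHx // expnS mul2n halfD doubleK odd_double.
  by rewrite andbF.
Qed.

Lemma hf_mem_set x s : hf_mem x (hf_set s) = (x \in s).
Proof.
elim: s => [|y s IHs]; first by rewrite /hf_mem div0n.
by rewrite /= hf_mem_insert IHs inE.
Qed.

Record graph := Graph {
  vertex :> Type;
  adj : vertex -> vertex -> Prop;
  adj_sym : forall x y, adj x y -> adj y x;
  adj_irrefl : forall x, ~ adj x x }.

Arguments adj {g}.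

Definition locally_finite (G : graph) : Prop :=
  forall x : G, finite_set [set y | adj x y].

(* The path metric satisfies rho(x, y) <= r: some walk of length at most r
   joins x to y (in particular the distance between components is infinite). *)
Fixpoint dist_le (G : graph) (r : nat) (x y : G) : Prop :=
  if r is r'.+1 then dist_le r' x y \/ exists2 z, dist_le r' x z & adj z y
  else x = y.

Definition component (G : graph) (x : G) : set G :=
  [set y | exists r, dist_le r x y].

Definition graph_iso (G H : graph) (f : G -> H) : Prop :=
  bijective f /\ forall x y, adj x y <-> adj (f x) (f y).

Section Operations.
Variable G : graph.

Section Induced.
Variable S : set G.
Definition induced_adj (x y : {x : G | S x}) := adj (sval x) (sval y).
Fact induced_sym x y : induced_adj x y -> induced_adj y x.
Proof. exact: adj_sym. Qed.
Fact induced_irrefl x : ~ induced_adj x x.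
Proof. exact: adj_irrefl. Qed.
Definition induced := Graph induced_sym induced_irrefl.
End Induced.

Lemma dist_le_refl r (x : G) : dist_le r x x.
Proof. by elim: r => // r IHr; left. Qed.

Lemma dist_leW r q (x y : G) : r <= q -> dist_le r x y -> dist_le q x y.
Proof.
move=> /subnKC<- xy; elim: (q - r) => [|m IHm]; first by rewrite addn0.
by rewrite addnS; left.
Qed.

Lemma dist_le_trans r q (x y z : G) :
  dist_le r x y -> dist_le q y z -> dist_le (r + q) x z.
Proof.
move=> xy; elim: q z => [z <-|q IHq z]; first by rewrite addn0.
by rewrite addnS => -[/IHq|[t /IHq xt tz]]; [left | right; exists t].
Qed.

Lemma dist_le_adj (x y : G) : adj x y -> dist_le 1 x y.
Proof. by move=> xy; right; exists x. Qed.

Lemma dist_le_sym r (x y : G) : dist_le r x y -> dist_le r y x.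
Proof.
elim: r x y => [x y ->|r IHr x y] //= [/IHr|[z /IHr zx /adj_sym/dist_le_adj yz]].
  by left.
exact: (dist_le_trans yz zx).
Qed.

Lemma component_refl (x : G) : component x x.
Proof. by exists 0. Qed.

Lemma component_eq (x y : G) : component x y -> component x = component y.
Proof.
move=> [r xy]; apply/seteqP; split=> z [q].
  by move=> xz; exists (r + q); apply: dist_le_trans xz; apply: dist_le_sym.
by move=> yz; exists (r + q); apply: dist_le_trans yz.
Qed.

Lemma component_adj (x y : G) : adj x y -> component x = component y.
Proof. by move=> xy; apply: component_eq; exists 1; apply: dist_le_adj. Qed.

Section Power.
Variable r : nat.
Definition power_adj (x y : G) := x <> y /\ dist_le r x y.
Fact power_sym x y : power_adj x y -> power_adj y x.
Proof. by case=> xy /dist_le_sym yx; split=> // /esym. Qed.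
Fact power_irrefl x : ~ power_adj x x.
Proof. by case. Qed.
Definition power := Graph power_sym power_irrefl.
End Power.

Definition colorable (n : nat) : Prop :=
  exists c : G -> 'I_n, forall x y, adj x y -> c x <> c y.

Definition chromatic_number (n : nat) : Prop :=
  colorable n /\ forall m, colorable m -> n <= m.

Definition clique (S : set G) : Prop :=
  forall x y, S x -> S y -> x <> y -> adj x y.

Definition clique_number (n : nat) : Prop :=
  (exists2 S, clique S & S #= `I_n) /\ (forall S, clique S -> S #<= `I_n).

End Operations.

(* Locally finite graphs have no infinite clique, so for them asking for a
   finite common value loses nothing. *)
Definition perfect (G : graph) : Prop :=
  forall S : set G, exists2 n,
    chromatic_number (induced S) n & clique_number (induced S) n.

Record coloring_problem := ColoringProblem {
  graph_class : graph -> Prop;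
  coloring_class : forall G : graph, (G -> HF) -> Prop;
  graph_class_lf : forall G, graph_class G -> locally_finite G;
  graph_class_iso : forall (G H : graph) (f : G -> H),
    graph_iso f -> graph_class G -> graph_class H;
  graph_class_component : forall G,
    graph_class G <-> forall x : G, graph_class (induced (component x));
  coloring_class_iso : forall (G H : graph) (f : G -> H) (c : H -> HF),
    graph_iso f -> graph_class G ->
    coloring_class (c \o f) -> coloring_class c;
  coloring_class_component : forall (G : graph) (c : G -> HF),
    graph_class G ->
    (coloring_class c <->
     forall x : G, coloring_class (fun y : induced (component x) => c (sval y))) }.

Definition linear_order (T : Type) (lt : T -> T -> Prop) : Prop :=
  [/\ forall x, ~ lt x x,
      forall x y z, lt x y -> lt y z -> lt x z &
      forall x y, x <> y -> lt x y \/ lt y x].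

(* A partition U_0, ..., U_s (with possibly empty parts) is given by the map
   sending each vertex to the index of its part. *)
Definition part (T : Type) (s : nat) (U : T -> 'I_s.+1) (i : 'I_s.+1) : set T :=
  [set x | U x = i].

Record asi_input (s : nat) := AsiInput {
  input_graph :> graph;
  input_finite : finite_set [set: input_graph];
  input_lt : input_graph -> input_graph -> Prop;
  input_linear : linear_order input_lt;
  input_part : input_graph -> 'I_s.+1;
  input_target : set input_graph }.

Arguments input_lt {s a}.
Arguments input_part {s a}.
Arguments input_target {s} a.

Record input_iso (s : nat) (I J : asi_input s) (f : I -> J) : Prop := InputIso {
  input_iso_graph : graph_iso f;
  input_iso_lt : forall x y, input_lt x y <-> input_lt (f x) (f y);
  input_iso_part : forall x, input_part x = input_part (f x);
  input_iso_target : forall x, input_target I x <-> input_target J (f x) }.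

Record asi_algorithm (s : nat) := AsiAlgorithm {
  run :> forall I : asi_input s, {x : I | input_target I x} -> HF;
  run_iso : forall (I J : asi_input s) (f : I -> J) (isof : input_iso f)
      (x : {x : I | input_target I x}),
    run x = run (exist _ (f (sval x))
                   (proj1 (input_iso_target isof (sval x)) (svalP x))) }.

(* Since inputs are finite and linearly ordered, each of them is isomorphic, by a
   unique isomorphism, to exactly one of the form below, with vertex set
   {0, ..., m - 1} in its usual order. This copy is a hereditarily finite set,
   the vertices being von Neumann ordinals. *)
Record canonical_input (s : nat) := CanonicalInput {
  can_size : nat;
  can_adj : rel 'I_can_size;
  can_sym : symmetric can_adj;
  can_irrefl : irreflexive can_adj;
  can_part : 'I_can_size -> 'I_s.+1;
  can_target : pred 'I_can_size }.

Section Canonical.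
Variables (s : nat) (J : canonical_input s).
Local Notation V := 'I_(can_size J).

Fact canonical_sym (x y : V) : can_adj x y -> can_adj y x.
Proof. by rewrite can_sym. Qed.
Fact canonical_irrefl (x : V) : ~ can_adj x x.
Proof. by rewrite can_irrefl. Qed.
Fact canonical_linear : linear_order (fun x y : V => x < y).
Proof.
split=> [x|x y z|x y /eqP]; first by rewrite ltnn.
  exact: ltn_trans.
by rewrite neq_ltn => /orP.
Qed.

Definition input_of_canonical : asi_input s :=
  @AsiInput s (Graph canonical_sym canonical_irrefl) finite_finset
    _ canonical_linear (@can_part s J) [set x | can_target x].

Definition hf_vertices (P : pred V) : HF :=
  hf_set [seq hf_nat x | x : V <- enum P].
Definition hf_relation (R : rel V) : HF :=
  hf_set [seq hf_pair (hf_nat p.1) (hf_nat p.2) 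
         | p : V * V <- enum {: V * V} & R p.1 p.2].

(* the tuple ((V, E), <, U_0, ..., U_s, C) *)
Definition input_code : HF :=
  hf_tuple (hf_pair (hf_vertices predT) (hf_relation (@can_adj s J)))
    (hf_relation (fun x y => x < y) ::
     rcons [seq hf_vertices (fun x => can_part x == i) | i <- enum 'I_s.+1]
       (hf_vertices (@can_target s J))).

(* the function C -> HF, as a set of pairs *)
Definition output_code (A : asi_algorithm s) : HF :=
  hf_set [seq hf_pair (hf_nat (sval x)) (A input_of_canonical x)
         | x : {x : V | can_target x} <- enum {: {x : V | can_target x}}].

End Canonical.

Definition computable (s : nat) (A : asi_algorithm s) : Prop :=
  exists2 f : nat -> nat, recursive1 f &
    forall J : canonical_input s, f (input_code J) = output_code J A.

Definition asi_witness (G : graph) (s r : nat) (U : G -> 'I_s.+1) : Prop :=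
  forall (i : 'I_s.+1) (x : @induced (power G r) (part U i)),
    finite_set (component x).

Lemma dist_le_finite (G : graph) (r : nat) (x : G) :
  locally_finite G -> finite_set [set y | dist_le r x y].
Proof.
move=> lfG; elim: r => [|r IHr].
  by apply: sub_finite_set (finite_set1 x) => y /= ->.
rewrite -[X in finite_set X]/([set y | dist_le r x y] `|`
  [set y | exists2 z, dist_le r x z & adj z y]).
rewrite finite_setU; split=> //.
apply: (@sub_finite_set _ _
  (\bigcup_(z in [set z | dist_le r x z]) [set y | adj z y])) => //.
exact: bigcup_finite.
Qed.

Section Run.
Variables (s r : nat) (G : graph) (U : G -> 'I_s.+1).

Definition is_cluster (D : set G) : Prop :=
  exists (i : 'I_s.+1) (x : @induced (power G r) (part U i)),
    D = sval @` component x.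

Definition cluster_adj (C D : {D : set G | is_cluster D}) :=
  C <> D /\ exists x y, [/\ sval C x, sval D y & dist_le r x y].
Fact cluster_sym C D : cluster_adj C D -> cluster_adj D C.
Proof.
move=> [neq [x [y [Cx Dy /dist_le_sym yx]]]].
by split=> [/esym //|]; exists y, x.
Qed.
Fact cluster_irrefl C : ~ cluster_adj C C.
Proof. by case. Qed.
Definition cluster_graph := Graph cluster_sym cluster_irrefl.

Definition cluster_of (v : G) : cluster_graph :=
  exist _ _ (ex_intro _ (U v) (ex_intro _
    (exist (part U (U v)) v erefl : @induced (power G r) _) erefl)).

Lemma cluster_of_mem v : sval (cluster_of v) v.
Proof. by exists (exist (part U (U v)) v erefl) => //; apply: component_refl. Qed.

Lemma cluster_ofE v (D : cluster_graph) : sval D v -> D = cluster_of v.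
Proof.
case: D => D [i [x eqD]] /= Dv; apply: eq_exist => /=.
move: Dv; rewrite eqD => -[[y Uy] xy /= yv].
subst y; move: (Uy); rewrite /part /= => Ui; subst i.
by rewrite (component_eq xy) (Prop_irrelevance Uy erefl).
Qed.

Definition window (n : nat) (C : cluster_graph) : set G :=
  [set v | exists2 D : cluster_graph, dist_le n C D & sval D v].

Lemma window_mem n v : window n (cluster_of v) v.
Proof. by exists (cluster_of v); [apply: dist_le_refl | apply: cluster_of_mem]. Qed.

Hypothesis lfG : locally_finite G.
Hypothesis wU : asi_witness r U.

Lemma cluster_finite (D : cluster_graph) : finite_set (sval D).
Proof. by case: D => D [i [x eqD]] /=; rewrite eqD; apply/finite_image/wU. Qed.

Lemma cluster_graph_lf : locally_finite cluster_graph.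
Proof.
move=> C; apply: (@sub_finite_set _ _
  (cluster_of @` \bigcup_(x in sval C) [set y | dist_le r x y])).
  by move=> D [_ [x [y [Cx Dy xy]]]]; exists y; [exists x | rewrite (cluster_ofE Dy)].
apply: finite_image; apply: bigcup_finite; first exact: cluster_finite.
by move=> x _; apply: dist_le_finite.
Qed.

Lemma window_finite n C : finite_set (window n C).
Proof.
apply: (@sub_finite_set _ _
  (\bigcup_(D in [set D : cluster_graph | dist_le n C D]) sval D)).
  by move=> v [D CD Dv]; exists D.
apply: bigcup_finite; first by apply: dist_le_finite; apply: cluster_graph_lf.
by move=> D _; apply: cluster_finite.
Qed.

Lemma induced_window_finite n C : finite_set [set: induced (window n C)].
Proof.
have /eq_finite_set <- : sval @` [set: induced (window n C)] #= [set: induced (window n C)].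
  by apply: inj_card_eq => -[x Wx] [y Wy] _ _ /= eq_xy; apply: eq_exist.
by apply: sub_finite_set (window_finite n C) => _ [[x Wx] _ <-].
Qed.

Variable lt : G -> G -> Prop.
Hypothesis linG : linear_order lt.

Lemma induced_linear (S : set G) :
  linear_order (fun x y : induced S => lt (sval x) (sval y)).
Proof.
have [irr tr tot] := linG; split=> [x|x y z|[x Sx] [y Sy] neq]; first exact: irr.
  exact: tr.
by apply: tot => eq_xy; apply: neq; apply: eq_exist.
Qed.

Definition window_input (n : nat) (C : cluster_graph) : asi_input s :=
  AsiInput (@induced_window_finite n C) (@induced_linear (window n C))
    (fun x => U (sval x)) [set x | sval C (sval x)].

(* A_n[(G, <, U_0, ..., U_s)] *)
Definition run_on (A : asi_algorithm s) (n : nat) (v : G) : HF :=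
  A (window_input n (cluster_of v))
    (exist _ (exist _ v (window_mem n v)) (cluster_of_mem v)).

End Run.

Definition ASI_c (s : nat) (P : coloring_problem) : Prop :=
  exists (A : asi_algorithm s) (n r : nat), computable A /\
    forall (G : graph) (GP : graph_class P G)
      (lt : G -> G -> Prop) (linG : linear_order lt)
      (U : G -> 'I_s.+1) (wU : asi_witness r U),
    coloring_class P (run_on (graph_class_lf GP) wU linG A n).


Definition graph_hom (G H : graph) (f : G -> H) : Prop :=
  forall x y, adj x y -> adj (f x) (f y).

Lemma colorable_hom (G H : graph) (f : G -> H) n :
  graph_hom f -> colorable H n -> colorable G n.
Proof. by move=> homf [c cP]; exists (c \o f) => x y /homf/cP. Qed.

Lemma clique_card_le (G : graph) (S : set G) n :
  clique S -> colorable G n -> S #<= `I_n.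
Proof.
move=> cS [c cP].
have cinj : {in S &, injective (fun x => c x : nat)}.
  move=> x y; rewrite !inE => Sx Sy /val_inj cxy.
  by apply: contrapT => /(cS _ _ Sx Sy)/cP.
rewrite -(card_le_eql (inj_card_eq cinj)).
by apply: subset_card_le => _ [x _ <-] /=.
Qed.

Lemma clique_image (G H : graph) (f : G -> H) (S : set G) :
  graph_hom f -> clique S -> clique (f @` S).
Proof.
move=> homf cS _ _ [x Sx <-] [y Sy <-] fxy; apply: homf; apply: cS => // xy.
by apply: fxy; rewrite xy.
Qed.

Lemma numbers_hom (G H : graph) (f : G -> H) (g : H -> G) n :
  graph_hom f -> graph_hom g -> injective g ->
  chromatic_number H n -> clique_number H n ->
  chromatic_number G n /\ clique_number G n.
Proof.
move=> homf homg ginj [cH minH] [[S cS Sn] _]; split; split.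
- exact: colorable_hom homf cH.
- by move=> m /(colorable_hom homg)/minH.
- exists (g @` S); first exact: clique_image.
  by rewrite (card_eql (inj_card_eq (in2W ginj))).
- by move=> T /clique_card_le; apply; apply: colorable_hom homf cH.
Qed.

Lemma perfect_embed (G H : graph) (f : G -> H) :
  injective f -> (forall x y, adj x y <-> adj (f x) (f y)) ->
  perfect H -> perfect G.
Proof.
move=> finj fE pH S; have [n chi omega] := pH (f @` S).
pose u (x : induced S) : induced (f @` S) := exist _ (f (sval x)) (imageP f (svalP x)).
have vP (y : induced (f @` S)) : exists x : induced S, f (sval x) = sval y.
  by case: y => y /= [x Sx <-]; exists (exist _ x Sx).
have [v {}vP] := choice vP.
have [] := @numbers_hom (induced S) (induced (f @` S)) u v n _ _ _ chi omega.
- by move=> x y /fE.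
- by move=> x y; rewrite /= /induced_adj fE !vP.
- move=> x y vxy; have := vP x; rewrite vxy vP.
  by case: x y {vxy} => [x Sx] [y Sy] /= eq_xy; apply: eq_exist.
- by exists n.
Qed.

Lemma perfect_induced (G : graph) (S : set G) : perfect G -> perfect (induced S).
Proof.
apply: (@perfect_embed (induced S) G sval) => // -[x Sx] [y Sy] /= eq_xy.
exact: eq_exist.
Qed.

Lemma colorable_glue (G : graph) (T : Type) (key : G -> T) n :
  (forall x y, adj x y -> key x = key y) ->
  (forall x, colorable (induced [set y | key y = key x]) n) -> colorable G n.
Proof.
move=> keyP col.
have [x0|noG] := pselect (exists x : G, True); last first.
  have F (x : G) : False by apply: noG; exists x.
  by exists (fun x => False_rect _ (F x)) => x; case: (F x).
have i0 : 'I_n by case: (cid x0) => x _; case: (cid (col x)) => c _;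
  exact: c (exist _ x erefl).
have cP t : exists c : G -> 'I_n,
    forall x y, key x = t -> key y = t -> adj x y -> c x <> c y.
  have [[x <-]|no] := pselect (exists x, key x = t); last first.
    by exists (fun=> i0) => x y kx; case: no; exists x.
  have [c cP] := col x.
  exists (fun y => if pselect (key y = key x) is left e then c (exist _ y e) else i0).
  move=> y z ky kz yz; case: pselect => // ey; case: pselect => // ez.
  exact: cP.
have [c {}cP] := choice cP.
by exists (fun x => c (key x) x) => x y xy; rewrite (keyP _ _ xy); apply: cP => //;
  apply: keyP.
Qed.

Lemma ex_chromatic (G : graph) k : colorable G k -> exists n, chromatic_number G n.
Proof.
move=> colk; have ex : exists n, `[< colorable G n >] by exists k; apply/asboolP.
exists (ex_minn ex); case: ex_minnP => n /asboolP coln minn; split=> // m colm.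
by apply: minn; apply/asboolP.
Qed.

Lemma perfect_components (G : graph) k : colorable G k ->
  (forall x : G, perfect (induced (component x))) -> perfect G.
Proof.
move=> colk pG S.
have colS : colorable (induced S) k.
  by apply: (@colorable_hom (induced S) G sval k _ colk) => x y.
have [n chi] := ex_chromatic colS; exists n => //; case: (chi) => coln minn.
split; last by move=> T /clique_card_le; apply.
case: n coln minn {chi} => [coln _|n coln minn].
  by exists set0 => //; rewrite II0 card_eq00.
pose key (x : induced S) := component (sval x).
have keyP x y : adj x y -> key x = key y by move=> xy; apply: (@component_adj G).
have [x ncol] : exists x, ~ colorable (induced [set y | key y = key x]) n.
  apply: contrapT => /forallNP noex.
  have /minn : colorable (induced S) n.
    by apply: (colorable_glue keyP) => x; apply: contrapT; apply: noex.
  by rewrite ltnn.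
set K := induced [set y | key y = key x] in ncol.
pose j (y : K) : induced (component (sval x)) :=
  exist _ (sval (sval y)) (eq_ind (key (sval y)) (fun C : set G => C (sval (sval y)))
    (component_refl _) _ (svalP y)).
have pK : perfect K.
  apply: (@perfect_embed K _ j) (pG (sval x)) => // -[[y Sy] ky] [[z Sz] kz] /=.
  by case=> eq_yz; apply: eq_exist; apply: eq_exist.
have [m [colm minm] [[T cT Tm] _]] := pK setT.
have lt_nm : n < m.
  rewrite ltnNge; apply/negP => le_mn; apply: ncol.
  have [c cP] := @colorable_hom K (induced [set: K]) (fun y => exist _ y I) m
    (fun _ _ => id) colm.
  by exists (fun y => widen_ord le_mn (c y)) => y z /cP; apply: contra_not => -[/val_inj].
pose h (y : induced [set: K]) : induced S := sval (sval y).
have hinj : injective h.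
  by move=> [[y ky] ?] [[z kz] ?] /= eq_yz; apply: eq_exist; apply: eq_exist.
have chT : clique (h @` T) by apply: (clique_image _ cT) => y z.
have hTm : h @` T #= `I_m.
  by rewrite (card_eql (inj_card_eq (in2W hinj))).
exists (h @` T) => //; suff -> : n.+1 = m by [].
apply/eqP; rewrite eqn_leq lt_nm -card_le_II -(card_le_eql hTm).
exact: clique_card_le.
Qed.

Section PerfectColoring.
Variables k s : nat.

Definition perfect_class (G : graph) : Prop :=
  [/\ locally_finite G, colorable G k & perfect G].

(* c takes its values in the von Neumann ordinal m *)
Definition proper_coloring (m : nat) (G : graph) (c : G -> HF) : Prop :=
  (forall x, exists2 i, i < m & c x = hf_nat i) /\
  (forall x y, adj x y -> c x <> c y).

Fact perfect_class_lf G : perfect_class G -> locally_finite G.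
Proof. by case. Qed.

Fact perfect_class_iso (G H : graph) (f : G -> H) :
  graph_iso f -> perfect_class G -> perfect_class H.
Proof.
move=> [[g fK gK] fE] [lfG colG pG].
have gE x y : adj x y <-> adj (g x) (g y) by rewrite fE !gK.
split.
- move=> x; apply: sub_finite_set (finite_image f (lfG (g x))) => y /gE xy.
  by exists (g y).
- by apply: (colorable_hom (f := g) _ colG) => x y /gE.
- exact: perfect_embed (can_inj gK) gE pG.
Qed.

Fact perfect_class_component G :
  perfect_class G <-> forall x : G, perfect_class (induced (component x)).
Proof.
split=> [[lfG colG pG] x|cG].
  split; last exact: perfect_induced.
    move=> y; have fin := lfG (sval y).
    have inj : {in [set z | adj y z] &, injective (@sval G (component x))}.
      by move=> [u Su] [v Sv] _ _ /= eq_uv; apply: eq_exist.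
    rewrite -(eq_finite_set (inj_card_eq inj)).
    by apply: sub_finite_set fin => _ [z yz <-].
  by apply: (@colorable_hom (induced (component x)) G sval k _ colG) => u v.
have colG : colorable G k.
  apply: (@colorable_glue G (set G) (@component G)) => [|x].
    exact: component_adj.
  pose K := induced [set y | component y = component x].
  pose j (y : K) : induced (component x) :=
    exist _ (sval y) (eq_ind (component (sval y)) (fun C : set G => C (sval y))
      (component_refl _) _ (svalP y)).
  have [_ col _] := cG x; exact: (@colorable_hom K _ j k (fun _ _ => id) col).
split=> //; last by apply: perfect_components colG _ => x; case: (cG x).
move=> x; have [/(_ (exist _ x (component_refl x))) fin _ _] := cG x.
apply: sub_finite_set (finite_image sval fin) => y xy.
have Cy : component x y by exists 1; apply: dist_le_adj.
by exists (exist _ y Cy).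
Qed.

Fact proper_coloring_iso m (G H : graph) (f : G -> H) (c : H -> HF) :
  graph_iso f -> perfect_class G ->
  proper_coloring m (c \o f) -> proper_coloring m c.
Proof.
move=> [[g fK gK] fE] _ [cm cP]; split=> [x|x y].
  by have := cm (g x); rewrite /= gK.
by rewrite -(gK x) -(gK y) -fE => /cP.
Qed.

Fact proper_coloring_component m (G : graph) (c : G -> HF) :
  perfect_class G ->
  (proper_coloring m c <->
   forall x : G, proper_coloring m (fun y : induced (component x) => c (sval y))).
Proof.
move=> _; split=> [[cm cP] x|cC]; first by split=> [y|y z /cP //]; apply: cm.
split=> [x|x y xy].
  by have [+ _] := cC x => /(_ (exist _ x (component_refl x))).
have Cy : component x y by exists 1; apply: dist_le_adj.
by have [_ /(_ (exist _ x (component_refl x)) (exist _ y Cy))] := cC x; apply.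
Qed.

Definition perfect_coloring_problem : coloring_problem :=
  ColoringProblem perfect_class_lf perfect_class_iso perfect_class_component
    (@proper_coloring_iso (k + s)) (@proper_coloring_component (k + s)).

End PerfectColoring.

(* Main.v *)
Require Import Defs.
From mathcomp Require Import all_boot.
From mathcomp Require Import boolp classical_sets functions cardinality.
From mathcomp Require Import zify.

Set Implicit Arguments.
Unset Strict Implicit.
Unset Printing Implicit Defensive.

Local Open Scope classical_set_scope.
Local Open Scope card_scope.

(* Step j = 0, ..., s of the algorithm colors with k + j colors the vertices close
   to U_0, ..., U_j. It keeps the colors of the previous step on a neighborhood of
   U_0, ..., U_{j-1} whose radius decreases with j, and takes the lexicographically
   least proper extension with one more color. Such an extension exists by
   [perfect_extension]: in a perfect graph, a K-coloring of a neighborhood of radius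
   3K of a set extends, from the set itself, to a (K+1)-coloring of the whole graph.
   At scale r the neighborhoods of distinct clusters of U_j are far apart, so the
   least extension is determined near each cluster separately and all windows agree.
   A coloring is coded by the number whose digits are the colors, so that least
   extensions are found by bounded search, which is primitive recursive. *)

(** * Recursive functions of environments *)

(** A proper coloring of a neighborhood need not extend with a single extra color if all of it is
    kept: only the colors near its core survive, and the layers around are recolored. This loss is
    why the radii shrink, by [3 * (k + s)] per step, down to 0 at step [s], where the neighborhood
    of [U_0, ..., U_s] is the whole graph. The largest radius fixes the scale: with [r] at least
    twice the radius plus one, vertices of [U_j] in different clusters have neighborhoods that
    neither meet nor are joined by an edge. Minimality makes the choice canonical: if two windows
    disagreed, grafting the coloring of one onto the other around a single cluster would beat a
    minimum. Windows are induced subgraphs, hence again perfect and [k]-colorable, so every step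
    succeeds inside each of them. *)

Definition rec (F : seq nat -> nat) : Prop :=
  forall k, recursive (fun v : k.-tuple nat => F v).

Lemma rec_ext F G : F =1 G -> rec F -> rec G.
Proof. by move=> FG rF k; apply: recursive_ext (rF k) => v. Qed.

Lemma rec_comp F (Gs : seq (seq nat -> nat)) :
  rec F -> (forall i, rec (nth (fun=> 0) Gs i)) ->
  rec (fun e => F [seq G e | G <- Gs]).
Proof.
move=> rF rG k.
pose h (i : 'I_(size Gs)) (v : k.-tuple nat) := nth (fun=> 0) Gs i v.
apply: (@recursive_ext _ (fun v => F [tuple h i v | i < size Gs])); last first.
  by apply: (@recursive_comp _ _ (fun v : (size Gs).-tuple nat => F v)) => // i;
    apply: rG.
move=> v; congr F; rewrite /h /= -[X in map _ X]/(enum 'I_(size Gs)).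
rewrite (map_comp (fun i => nth (fun=> 0) Gs i v) val) val_enum_ord.
apply: (@eq_from_nth _ 0); rewrite !size_map ?size_iota // => i lti.
by rewrite (nth_map 0) ?size_iota // nth_iota // (nth_map (fun=> 0)).
Qed.

(** Reading past the end of the environment gives 0, which is what lets a single statement [rec F]
    cover all arities. *)
Lemma rec_nth i : rec (fun e => nth 0 e i).
Proof.
move=> k; have [lt_ik|le_ki] := ltnP i k.
  apply: recursive_ext (recursive_proj (Ordinal lt_ik)) => v.
  by rewrite (tnth_nth 0).
apply: recursive_ext (recursive_zero k) => v.
by rewrite nth_default ?size_tuple.
Qed.

(* Environments are extended at the front: the variable bound [i] binders ago
   is [head 0 (iter i behead e)]. *)
Lemma rec_var i : rec (fun e => head 0 (iter i behead e)).
Proof.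
apply: rec_ext (rec_nth i) => e; elim: i e => [|i IHi] e; first by case: e.
by rewrite iterSr -IHi; case: e => //=; rewrite nth_nil.
Qed.

Lemma rec_succ F : rec F -> rec (fun e => (F e).+1).
Proof.
move=> rF k; pose h (i : 'I_1) (v : k.-tuple nat) := F v.
have := recursive_comp recursive_succ (fun i : 'I_1 => rF k : recursive (h i)).
by apply: recursive_ext => v; rewrite /thead tnth_mktuple.
Qed.

Lemma rec_cst n : rec (fun=> n).
Proof. by elim: n => [k|n /rec_succ //]; apply: recursive_zero. Qed.

Lemma rec_prim0 g h : rec g -> rec h ->
  rec (fun e => nat_rect (fun=> nat) (g (behead e))
    (fun n a => h (n :: a :: behead e)) (head 0 e)).
Proof.
move=> rg rh [|k].
  (* In the empty environment the recursion bound reads as 0, so only [g] is evaluated. *)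
  apply: recursive_ext (rg 0) => v; by rewrite (tuple0 v).
have := recursive_prim (rg k) (rh k.+2); apply: recursive_ext => v.
by case/tupleP: v => x v /=; rewrite theadE.
Qed.

(** Reduces the claim for arbitrary arguments to the claim for variables, which no longer depends on
    the environment in which [f] is used. *)
Lemma rec1 (f : nat -> nat) F :
  rec (fun e => f (head 0 e)) -> rec F -> rec (fun e => f (F e)).
Proof.
move=> rf rF; apply: (@rec_comp _ [:: F]) rf _ => -[|i] //=.
by rewrite nth_nil; apply: rec_cst.
Qed.

Lemma rec2 (f : nat -> nat -> nat) F G :
  rec (fun e => f (head 0 e) (head 0 (behead e))) ->
  rec F -> rec G -> rec (fun e => f (F e) (G e)).
Proof.
move=> rf rF rG; apply: (@rec_comp _ [:: F; G]) rf _ => -[|[|i]] //=.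
by rewrite nth_nil; apply: rec_cst.
Qed.

Lemma rec3 (f : nat -> nat -> nat -> nat) F G H :
  rec (fun e => f (head 0 e) (head 0 (behead e)) (head 0 (behead (behead e)))) ->
  rec F -> rec G -> rec H -> rec (fun e => f (F e) (G e) (H e)).
Proof.
move=> rf rF rG rH; apply: (@rec_comp _ [:: F; G; H]) rf _ => -[|[|[|i]]] //=.
by rewrite nth_nil; apply: rec_cst.
Qed.

(** With [n = 0] this binds a value in front of the environment; with [n = 2] it also discards the
    counter and the accumulator of a primitive recursion. *)
Lemma rec_subst F G n : rec F -> rec G -> rec (fun e => F (G e :: drop n e)).
Proof.
move=> rF rG k.
pose H (i : 'I_(k - n).+1) (v : k.-tuple nat) :=
  if unlift ord0 i is Some j then nth 0 v (n + j) else G v.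
have rH i : recursive (H i).
  by rewrite /H; case: unliftP => [j _|_]; [apply: rec_nth | apply: rG].
apply: recursive_ext (recursive_comp (rF _) rH) => v /=; congr F.
rewrite -[X in map _ X]/(enum 'I_(k - n).+1) enum_ordSl /= {1}/H unlift_none.
congr (_ :: _); rewrite -map_comp.
apply: (@eq_from_nth _ 0); rewrite size_map size_enum_ord ?size_drop ?size_tuple //.
move=> i lt_i; rewrite (nth_map (Ordinal lt_i)) ?size_enum_ord //= /H liftK nth_drop.
by rewrite nth_enum_ord.
Qed.

Lemma rec_prim (N g : seq nat -> nat) (h : seq nat -> nat -> nat -> nat) :
  rec N -> rec g ->
  rec (fun e => h (behead (behead e)) (head 0 e) (head 0 (behead e))) ->
  rec (fun e => nat_rect (fun=> nat) (g e) (h e) (N e)).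
Proof.
move=> rN rg rh; have := rec_subst 0 (rec_prim0 rg rh) rN.
by apply: rec_ext => e /=; rewrite drop0.
Qed.

Definition recb (P : seq nat -> bool) : Prop := rec (fun e => P e : nat).

Lemma recb_ext P Q : P =1 Q -> recb P -> recb Q.
Proof. by move=> PQ; apply: rec_ext => e; rewrite PQ. Qed.

Lemma recb2 (p : nat -> nat -> bool) F G :
  recb (fun e => p (head 0 e) (head 0 (behead e))) ->
  rec F -> rec G -> recb (fun e => p (F e) (G e)).
Proof. exact: (@rec2 p). Qed.

Lemma recb3 (p : nat -> nat -> nat -> bool) F G H :
  recb (fun e => p (head 0 e) (head 0 (behead e)) (head 0 (behead (behead e)))) ->
  rec F -> rec G -> rec H -> recb (fun e => p (F e) (G e) (H e)).
Proof. exact: (@rec3 p). Qed.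

Lemma rec_add F G : rec F -> rec G -> rec (fun e => F e + G e).
Proof.
apply: (@rec2 addn); apply: (@rec_ext (fun e => nat_rect (fun=> nat)
  (head 0 (behead e)) (fun _ a => a.+1) (head 0 e))).
  by move=> e; elim: (head 0 e) => //= n ->; rewrite addSn.
apply: (@rec_prim _ _ (fun _ _ a => a.+1)); [exact: (rec_var 0)|exact: (rec_var 1)|].
exact/rec_succ/(rec_var 1).
Qed.

Lemma rec_mul F G : rec F -> rec G -> rec (fun e => F e * G e).
Proof.
apply: (@rec2 muln); apply: (@rec_ext (fun e => nat_rect (fun=> nat)
  0 (fun _ a => head 0 (behead e) + a) (head 0 e))).
  by move=> e; elim: (head 0 e) => //= n ->; rewrite mulSn.
apply: (@rec_prim _ _ (fun e _ a => head 0 (behead e) + a));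
  [exact: (rec_var 0)|exact: rec_cst|].
by apply: rec_add; [exact: (rec_var 3)|exact: (rec_var 1)].
Qed.

Lemma rec_exp F G : rec F -> rec G -> rec (fun e => F e ^ G e).
Proof.
apply: (@rec2 expn); apply: (@rec_ext (fun e => nat_rect (fun=> nat)
  1 (fun _ a => head 0 e * a) (head 0 (behead e)))).
  by move=> e; elim: (head 0 (behead e)) => //= n ->; rewrite expnS.
apply: (@rec_prim _ _ (fun e _ a => head 0 e * a));
  [exact: (rec_var 1)|exact: rec_cst|].
by apply: rec_mul; [exact: (rec_var 2)|exact: (rec_var 1)].
Qed.

Lemma rec_pred F : rec F -> rec (fun e => (F e).-1).
Proof.
apply: (@rec1 predn); apply: (@rec_ext (fun e => nat_rect (fun=> nat)
  0 (fun n _ => n) (head 0 e))); first by move=> e; case: (head 0 e).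
by apply: (@rec_prim _ _ (fun e n a => n));
  [exact: (rec_var 0)|exact: rec_cst|exact: (rec_var 0)].
Qed.

Lemma rec_sub F G : rec F -> rec G -> rec (fun e => F e - G e).
Proof.
apply: (@rec2 subn); apply: (@rec_ext (fun e => nat_rect (fun=> nat)
  (head 0 e) (fun _ a => a.-1) (head 0 (behead e)))).
  by move=> e; elim: (head 0 (behead e)) => [|n IHn] /=; rewrite ?subn0 ?subnS ?IHn.
apply: (@rec_prim _ _ (fun e _ a => a.-1));
  [exact: (rec_var 1)|exact: (rec_var 0)|apply: rec_pred; exact: (rec_var 1)].
Qed.

Lemma recb_leq F G : rec F -> rec G -> recb (fun e => F e <= G e).
Proof.
move=> rF rG; apply: (@rec_ext (fun e => 1 - (F e - G e))).
  by move=> e; rewrite /leq; case: (F e - G e).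
by apply: rec_sub; [exact: rec_cst|apply: rec_sub].
Qed.

Lemma recb_neg P : recb P -> recb (fun e => ~~ P e).
Proof.
move=> rP; apply: (@rec_ext (fun e => 1 - P e)); first by move=> e; case: (P e).
by apply: rec_sub => //; apply: rec_cst.
Qed.

Lemma recb_and P Q : recb P -> recb Q -> recb (fun e => P e && Q e).
Proof.
move=> rP rQ; apply: (@rec_ext (fun e => P e * Q e)).
  by move=> e; case: (P e); case: (Q e).
exact: rec_mul.
Qed.

Lemma recb_or P Q : recb P -> recb Q -> recb (fun e => P e || Q e).
Proof.
move=> rP rQ; apply: (@recb_ext (fun e => ~~ (~~ P e && ~~ Q e))).
  by move=> e; rewrite negb_and !negbK.
by apply: recb_neg; apply: recb_and; apply: recb_neg.
Qed.

Lemma recb_imply P Q : recb P -> recb Q -> recb (fun e => P e ==> Q e).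
Proof.
move=> rP rQ; apply: (@recb_ext (fun e => ~~ P e || Q e)).
  by move=> e; rewrite implybE.
by apply: recb_or => //; apply: recb_neg.
Qed.

Lemma recb_eq F G : rec F -> rec G -> recb (fun e => F e == G e).
Proof.
move=> rF rG; apply: (@recb_ext (fun e => (F e <= G e) && (G e <= F e))).
  by move=> e; rewrite eqn_leq.
by apply: recb_and; apply: recb_leq.
Qed.

Lemma rec_if P F G : recb P -> rec F -> rec G ->
  rec (fun e => if P e then F e else G e).
Proof.
move=> rP rF rG; apply: (@rec_ext (fun e => P e * F e + (~~ P e) * G e)).
  by move=> e; case: (P e); rewrite ?mul1n ?mul0n ?addn0 ?add0n.
by apply: rec_add; apply: rec_mul => //; exact: (recb_neg rP).
Qed.

(** * Bounded search and bounded quantifiers *)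

Definition bmin (N : nat) (P : pred nat) : nat := find P (iota 0 N).

(** The value [N] doubles as the mark of a failed search below [N], so the accumulator of the
    primitive recursion is a single number. *)
Lemma bminS N P : bmin N.+1 P =
  if (bmin N P == N) && ~~ P N then N.+1 else bmin N P.
Proof.
rewrite /bmin -addn1 iotaD add0n find_cat size_iota /= addn1.
have := has_find P (iota 0 N); rewrite size_iota => ->.
have := find_size P (iota 0 N); rewrite size_iota leq_eqVlt.
case: eqP => [->|_] /=; first by rewrite ltnn; case: (P N); rewrite ?addn0 ?addn1.
by move=> ->.
Qed.

Lemma bmin_le N P : bmin N P <= N.
Proof. by rewrite -[X in _ <= X](size_iota 0) find_size. Qed.

Lemma bminP N (P : pred nat) : bmin N P < N -> P (bmin N P).
Proof.
rewrite /bmin => lt_N; rewrite -[X in P X]add0n -(nth_iota 0 0 lt_N).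
by apply: nth_find; rewrite has_find size_iota.
Qed.

Lemma bmin_min N (P : pred nat) i : i < N -> P i -> bmin N P <= i.
Proof.
move=> lt_iN Pi; rewrite leqNgt; apply/negP => lt_i.
by have := before_find 0 lt_i; rewrite nth_iota // Pi.
Qed.

Lemma bmin_ltP N (P : pred nat) : reflect (exists2 i, i < N & P i) (bmin N P < N).
Proof.
apply: (iffP idP) => [lt_N|[i lt_i Pi]]; first by exists (bmin N P); rewrite ?bminP.
exact: leq_ltn_trans (bmin_min lt_i Pi) lt_i.
Qed.

Definition allb (N : nat) (P : pred nat) : bool := N <= bmin N (predC P).

Lemma allbP N (P : pred nat) : reflect (forall i, i < N -> P i) (allb N P).
Proof.
rewrite /allb leqNgt; apply: (iffP idP) => [no i lt_i|all_P].
  by apply/negPn/negP => nPi; case/negP: no; apply/bmin_ltP; exists i.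
by apply/bmin_ltP => -[i /all_P /= ->].
Qed.

Definition exb (N : nat) (P : pred nat) : bool := bmin N P < N.

Lemma exbP N (P : pred nat) : reflect (exists2 i, i < N & P i) (exb N P).
Proof. exact: bmin_ltP. Qed.

Lemma rec_bmin N (P : seq nat -> nat -> bool) :
  rec N -> recb (fun e => P (behead e) (head 0 e)) ->
  rec (fun e => bmin (N e) (P e)).
Proof.
move=> rN rP.
apply: (@rec_ext (fun e => nat_rect (fun=> nat) 0
  (fun n a => if (a == n) && ~~ P e n then n.+1 else a) (N e))).
  by move=> e; elim: (N e) => //= n ->; rewrite bminS.
apply: (@rec_prim _ _ (fun e n a => if (a == n) && ~~ P e n then n.+1 else a)) => //.
  exact: rec_cst.
apply: rec_if; [|exact/rec_succ/(rec_var 0)|exact: (rec_var 1)].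
apply: recb_and; first by apply: recb_eq; [exact: (rec_var 1)|exact: (rec_var 0)].
apply: recb_neg; apply: rec_ext (rec_subst 2 rP (rec_var 0)) => e /=.
by case: e => [|? [|? ?]] //=; rewrite drop0.
Qed.

Lemma recb_all N (P : seq nat -> nat -> bool) :
  rec N -> recb (fun e => P (behead e) (head 0 e)) ->
  recb (fun e => allb (N e) (P e)).
Proof.
move=> rN rP; apply: recb_leq => //.
by apply: (@rec_bmin _ (fun e n => ~~ P e n)) => //; apply: recb_neg.
Qed.

Lemma recb_ex N (P : seq nat -> nat -> bool) :
  rec N -> recb (fun e => P (behead e) (head 0 e)) ->
  recb (fun e => exb (N e) (P e)).
Proof. by move=> rN rP; apply: recb_leq => //; apply/rec_succ/rec_bmin. Qed.

Lemma rec_div F G : rec F -> rec G -> rec (fun e => F e %/ G e).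
Proof.
(* The quotient of [a] by [d] is the least [q] with [a < (q + 1) * d]. If no such [q] lies below
   [a], the search returns [a], which is then the quotient. *)
apply: (@rec2 divn); apply: (@rec_ext (fun e =>
  if head 0 (behead e) == 0 then 0 else
  bmin (head 0 e) (fun q => head 0 e < q.+1 * head 0 (behead e)))).
  move=> e; set a := head 0 e; set d := head 0 _.
  case: eqP => [->|/eqP]; rewrite ?divn0 // -lt0n => d_gt0.
  have lt_a q : (a < q.+1 * d) = (a %/ d <= q) by rewrite -ltn_divLR.
  apply/eqP; rewrite eqn_leq; apply/andP; split; last first.
    have := bmin_le a (fun q => a < q.+1 * d); rewrite leq_eqVlt => /orP[/eqP->|].
      exact: leq_div.
    by move/bminP; rewrite lt_a.
  have := leq_div a d; rewrite leq_eqVlt => /orP[/eqP->|lt_q]; first exact: bmin_le.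
  by apply: bmin_min => //; rewrite lt_a.
apply: rec_if; [|exact: rec_cst|].
  by apply: recb_eq; [exact: (rec_var 1)|exact: rec_cst].
apply: (@rec_bmin _ (fun e q => head 0 e < q.+1 * head 0 (behead e))).
  exact: (rec_var 0).
apply: recb_leq; first by apply: rec_succ; exact: (rec_var 1).
by apply: rec_mul; [apply: rec_succ; exact: (rec_var 0)|exact: (rec_var 2)].
Qed.

Lemma rec_mod F G : rec F -> rec G -> rec (fun e => F e %% G e).
Proof.
move=> rF rG; apply: (@rec_ext (fun e => F e - F e %/ G e * G e)).
  by move=> e; rewrite {1}(divn_eq (F e) (G e)) addKn.
by apply: rec_sub => //; apply: rec_mul => //; apply: rec_div.
Qed.

Lemma recb_hf_mem F G : rec F -> rec G -> recb (fun e => hf_mem (F e) (G e)).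
Proof.
move=> rF rG; apply: (@rec_ext (fun e => (G e %/ 2 ^ F e) %% 2)).
  by move=> e; rewrite modn2.
apply: rec_mod; [apply: rec_div => //; apply: rec_exp => //|]; exact: rec_cst.
Qed.

Lemma rec_hf_insert F G : rec F -> rec G -> rec (fun e => hf_insert (F e) (G e)).
Proof.
move=> rF rG; apply: rec_if => //; first exact: recb_hf_mem.
by apply: rec_add => //; apply: rec_exp => //; apply: rec_cst.
Qed.

Lemma rec_hf_pair F G : rec F -> rec G -> rec (fun e => hf_pair (F e) (G e)).
Proof.
by move=> rF rG; do ![apply: rec_hf_insert => //]; apply: rec_cst.
Qed.

Lemma rec_hf_nat F : rec F -> rec (fun e => hf_nat (F e)).
Proof.
apply: (@rec1 hf_nat); apply: (@rec_ext (fun e => nat_rect (fun=> nat)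
  0 (fun _ a => hf_insert a a) (head 0 e))).
  by move=> e; elim: (head 0 e) => //= n ->.
apply: (@rec_prim _ _ (fun _ _ a => hf_insert a a));
  [exact: (rec_var 0)|exact: rec_cst|].
by apply: rec_hf_insert; exact: (rec_var 1).
Qed.

(** * Ordinals and pairs as hereditarily finite sets *)

Lemma hf_mem_lt x a : hf_mem x a -> x < a.
Proof.
move=> xa; apply: leq_trans (ltn_expl x (isT : 1 < 2)) _.
by rewrite leqNgt; apply/negP => lt_a; move: xa; rewrite /hf_mem divn_small.
Qed.

Lemma hf_mem_nat x n : hf_mem x (hf_nat n) = (x \in [seq hf_nat i | i <- iota 0 n]).
Proof.
elim: n => [|n IHn]; first by rewrite /hf_mem div0n.
by rewrite -addn1 iotaD map_cat mem_cat addn1 /= hf_mem_insert IHn inE orbC.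
Qed.

Lemma hf_nat_inj : injective hf_nat.
Proof.
suff lt_nat i j : i < j -> hf_nat i < hf_nat j.
  by move=> i j eq_ij; case: (ltngtP i j) => // /lt_nat; rewrite eq_ij ltnn.
move=> lt_ij; apply: hf_mem_lt; rewrite hf_mem_nat; apply: map_f.
by rewrite mem_iota.
Qed.

Lemma hf_pair_inj x y x' y' : hf_pair x y = hf_pair x' y' -> x = x' /\ y = y'.
Proof.
have set1_inj a b : hf_set [:: a] = hf_set [:: b] -> a = b.
  by move=> /(congr1 (hf_mem a)); rewrite !hf_mem_set !inE eqxx => /esym/eqP.
have set12 a b c : hf_set [:: a] = hf_set [:: b; c] -> a = b /\ a = c.
  move=> eq_a; have := congr1 (hf_mem b) eq_a; have := congr1 (hf_mem c) eq_a.
  by rewrite !hf_mem_set !inE !eqxx orbT => /eqP-> /eqP->.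
have set2_inj a b c : hf_set [:: a; b] = hf_set [:: a; c] -> b = c.
  move=> eq_b; have := congr1 (hf_mem b) eq_b; have := congr1 (hf_mem c) eq_b.
  by rewrite !hf_mem_set !inE !eqxx !orbT => /orP[/eqP->|/eqP//] /esym/orP[]/eqP.
move=> eq_p.
have mem_p u : (u \in [:: hf_set [:: x]; hf_set [:: x; y]])
    = (u \in [:: hf_set [:: x']; hf_set [:: x'; y']]).
  by rewrite -!hf_mem_set; congr hf_mem.
have eq_x : x = x'.
  have := mem_p (hf_set [:: x]); rewrite !inE eqxx /= => /esym/orP[]/eqP.
    exact: set1_inj.
  by case/set12.
subst x'; split=> //.
have := mem_p (hf_set [:: x; y]); rewrite !inE eqxx orbT => /esym/orP[]/eqP.
  move=> /esym/set12[_ eq_y].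
  have := mem_p (hf_set [:: x; y']); rewrite !inE eqxx !orbT => /orP[]/eqP/esym.
    by case/set12; rewrite -eq_y.
  by move/esym/set2_inj.
exact: set2_inj.
Qed.

Lemma hf_pair_lt x y : (x < hf_pair x y) /\ (y < hf_pair x y).
Proof.
have lt2 u v a : hf_mem u v -> hf_mem v a -> u < a.
  by move=> /hf_mem_lt uv /hf_mem_lt; apply: ltn_trans.
by split; apply: (lt2 _ (hf_set [:: x; y])); rewrite hf_mem_set !inE eqxx ?orbT.
Qed.

(** Elements have smaller codes than the sets containing them, so both components of a pair are
    found below the code of the pair. *)
Definition hf_fst (p : HF) : HF := bmin p (fun x => exb p (fun y => p == hf_pair x y)).
Definition hf_snd (p : HF) : HF := bmin p (fun y => exb p (fun x => p == hf_pair x y)).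

Lemma hf_fstE x y : hf_fst (hf_pair x y) = x.
Proof.
have [lt_x lt_y] := hf_pair_lt x y.
suff /bminP/exbP[z _ /eqP/hf_pair_inj[]] : hf_fst (hf_pair x y) < hf_pair x y by [].
by apply/bmin_ltP; exists x => //; apply/exbP; exists y.
Qed.

Lemma hf_sndE x y : hf_snd (hf_pair x y) = y.
Proof.
have [lt_x lt_y] := hf_pair_lt x y.
suff /bminP/exbP[z _ /eqP/hf_pair_inj[]] : hf_snd (hf_pair x y) < hf_pair x y by [].
by apply/bmin_ltP; exists y => //; apply/exbP; exists x.
Qed.

Lemma rec_hf_fst F : rec F -> rec (fun e => hf_fst (F e)).
Proof.
apply: (@rec1 hf_fst); apply: (@rec_bmin _ (fun e x =>
  exb (head 0 e) (fun y => head 0 e == hf_pair x y))); first exact: (rec_var 0).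
apply: (@recb_ex _ (fun e y => head 0 (behead e) == hf_pair (head 0 e) y)).
  exact: (rec_var 1).
apply: recb_eq; first exact: (rec_var 2).
by apply: rec_hf_pair; [exact: (rec_var 1)|exact: (rec_var 0)].
Qed.

Lemma rec_hf_snd F : rec F -> rec (fun e => hf_snd (F e)).
Proof.
apply: (@rec1 hf_snd); apply: (@rec_bmin _ (fun e y =>
  exb (head 0 e) (fun x => head 0 e == hf_pair x y))); first exact: (rec_var 0).
apply: (@recb_ex _ (fun e x => head 0 (behead e) == hf_pair x (head 0 e))).
  exact: (rec_var 1).
apply: recb_eq; first exact: (rec_var 2).
by apply: rec_hf_pair; [exact: (rec_var 0)|exact: (rec_var 1)].
Qed.

(** * Extending colorings of perfect graphs *)

Lemma clique_size_le (G : graph) (Q : set G) n m (c : G -> nat) :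
  clique Q -> Q #= `I_n -> (forall x, Q x -> c x < m) ->
  (forall x y, Q x -> Q y -> adj x y -> c x <> c y) -> n <= m.
Proof.
move=> cQ Qn cm cP; rewrite -card_le_II -(card_le_eql Qn).
have cinj : {in Q &, injective c}.
  move=> x y; rewrite !inE => Qx Qy cxy; apply: contrapT => /(cQ _ _ Qx Qy) xy.
  exact: cP cxy.
rewrite -(card_le_eql (inj_card_eq cinj)).
by apply: subset_card_le => _ [x Qx <-] /=; apply: cm.
Qed.

(** Colorings of subsets are total functions with irrelevant values elsewhere, so that induction on
    subsets never leaves the graph [G]. *)
Lemma perfect_colorable (G : graph) (S : set G) m : perfect G ->
  (forall Q n, clique Q -> Q `<=` S -> Q #= `I_n -> n <= m) ->
  exists c : G -> nat, (forall x, S x -> c x < m) /\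
    (forall x y, S x -> S y -> adj x y -> c x <> c y).
Proof.
move=> pG Sm; have [n [[c cP] _] [[Q cQ Qn] _]] := pG S.
have le_nm : n <= m.
  apply: (Sm (sval @` Q)).
  - by apply: (@clique_image (induced S) G sval).
  - by move=> _ [[x Sx] _ <-].
  - have inj : {in Q &, injective (@sval G S)}.
      by move=> [u Su] [v Sv] _ _ /= eq_uv; apply: eq_exist.
    by rewrite (card_eql (inj_card_eq inj)).
exists (fun x => if pselect (S x) is left Sx then c (exist _ x Sx) : nat else 0).
split=> [x Sx|x y Sx Sy xy].
  by case: pselect => // Sx'; apply: leq_trans le_nm.
by case: pselect => // Sx'; case: pselect => // Sy' /val_inj; apply: cP.
Qed.

(* The colors are 0, ..., K, where 0 is the additional color. The class of K is
   made of the class of K in c up to layer 3K-1 and, from there on, of the class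
   of K in an auxiliary K-coloring d; where the two overlap, the latter gets 0.
   Every K-clique lies on one side, so what is left contains none of them. *)
Lemma perfect_extension (G : graph) (L : nat -> set G) (S : set G) K (c : G -> nat) :
  perfect G ->
  (forall d, L d `<=` L d.+1) -> (forall d x y, adj x y -> L d x -> L d.+1 y) ->
  (forall Q n, clique Q -> Q `<=` S -> Q #= `I_n -> n <= K) ->
  (forall x, S x -> L (3 * K) x -> 0 < c x <= K) ->
  (forall x y, S x -> S y -> L (3 * K) x -> L (3 * K) y -> adj x y -> c x <> c y) ->
  exists f : G -> nat, [/\ forall x, S x -> f x <= K,
    forall x y, S x -> S y -> adj x y -> f x <> f y,
    forall x, S x -> L 0 x -> f x = c x &
    forall x, S x -> ~ L (3 * K) x -> 0 < f x].
Proof.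
move=> pG Lmono Ladj; elim: K S => [|K IHK] S Scl cS cP.
  have S0 x : ~ S x.
    move=> Sx; have := @Scl [set x] 1; suff: [set x] #= `I_1.
      by move=> x1 /(_ _ _ x1); rewrite ltnn => /(_ _ _)/negP; apply=> // [? ? -> ->|? ->].
    exact: card_set1.
  by exists (fun=> 0); split=> [//|x y /S0|x /S0|x /S0].
have Lle d d' x : d <= d' -> L d x -> L d' x.
  by move=> /subnKC<-; elim: (d' - d) => [|n IHn]; rewrite ?addn0 ?addnS // => /IHn/Lmono.
(* Three layers per color: [Y] avoids [L (3K+1)], so its neighbors avoid [L (3K)] and get a nonzero
   color from the induction; a clique meeting [L (3K+1)] lies in [L (3K+2)], where [c] bounds it;
   [L (3K+3)] contains all neighbors of [X], so the part of [Y] beyond it can share the color [K+1]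
   with [X]. *)
pose a := 3 * K + 2.
have [d [dK dP]] := perfect_colorable pG Scl.
pose X := [set x | L a x /\ c x = K.+1].
pose Y := [set x | ~ L a.-1 x /\ d x = K].
pose W := [set x | [/\ S x, ~ X x & ~ Y x]].
have La x : L a x -> L (3 * K.+1) x by apply: Lle; rewrite /a; lia.
have Wcl Q n : clique Q -> Q `<=` W -> Q #= `I_n -> n <= K.
  move=> cQ QW Qn.
  have [[x0 [Qx0 Lx0]]|noL] := pselect (exists x, Q x /\ L a.-1 x); last first.
    apply: (@clique_size_le _ Q n K d) => // [x Qx|x y Qx Qy].
      have [Sx _ nY] := QW _ Qx; have := dK _ Sx; rewrite ltnS leq_eqVlt.
      by case/orP=> // /eqP dx; case: nY; split=> // Lx; apply: noL; exists x.
    by have [Sx _ _] := QW _ Qx; have [Sy _ _] := QW _ Qy; apply: dP.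
  have QL x : Q x -> L a x.
    move=> Qx; have [<-|neq] := pselect (x0 = x); first by apply: Lle Lx0; rewrite leq_pred.
    have xx0 := cQ _ _ Qx0 Qx neq; have := Ladj _ _ _ xx0 Lx0.
    by rewrite /a addn2.
  apply: (@clique_size_le _ Q n K (fun x => (c x).-1)) => // [x Qx|x y Qx Qy xy].
    have [Sx nX _] := QW _ Qx; have /andP[] := cS _ Sx (La _ (QL _ Qx)).
    have : c x <> K.+1 by move=> cx; apply: nX; split=> //; apply: QL.
    lia.
  have [Sx _ _] := QW _ Qx; have [Sy _ _] := QW _ Qy.
  have := cP _ _ Sx Sy (La _ (QL _ Qx)) (La _ (QL _ Qy)) xy.
  have := cS _ Sx (La _ (QL _ Qx)); have := cS _ Sy (La _ (QL _ Qy)).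
  lia.
have LK x : L (3 * K) x -> L a x by apply: Lle; rewrite /a; lia.
have [||f [fK fP fc f0]] := IHK W Wcl.
- move=> x [Sx nX _] Lx; have := cS _ Sx (La _ (LK _ Lx)).
  by have : c x <> K.+1 by [move=> cx; apply: nX; split=> //; apply: LK]; lia.
- by move=> x y [Sx _ _] [Sy _ _] /LK/La Lx /LK/La Ly; apply: cP.
pose g x := if `[< X x >] then K.+1 else
  if `[< Y x >] then (if `[< L a.+1 x >] then 0 else K.+1) else f x.
have gP x y : S x -> S y -> adj x y -> g x = g y -> False.
  have sym : forall x y, adj x y -> adj y x := @adj_sym G.
  move=> Sx Sy xy.
  wlog : x y Sx Sy xy / X x \/ (~ X x /\ ~ X y /\ (Y x \/ ~ Y x /\ ~ Y y)).
    move=> wl; have [Xx|nXx] := pselect (X x); first by apply: wl => //; left.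
    have [Xy|nXy] := pselect (X y).
      by move=> /esym; apply: wl => //; [exact: sym|left].
    have [Yx|nYx] := pselect (Y x); first by apply: wl => //; right; do !split=> //; left.
    have [Yy|nYy] := pselect (Y y); last by apply: wl => //; right; do !split=> //; right.
    by move=> /esym; apply: wl => //; [exact: sym|right; do !split=> //; left].
  have fW z : S z -> ~ X z -> ~ Y z -> f z < K.+1 by move=> Sz nX nY; apply: fK.
  rewrite /g => -[Xx|[nX [nX' [Yx|[nY nY']]]]].
  - rewrite asboolT //; case: asboolP => [Xy _|nX].
      have [[Lx cx] [Ly cy]] := (Xx, Xy).
      by apply: (cP x y) => //; [exact: La|exact: La|rewrite cx].
    case: asboolP => [_|nY e]; last by have := fW _ Sy nX nY; rewrite -e ltnn.
    by case: asboolP => // nL _; apply: nL; apply: Ladj xy _; case: Xx.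
  - rewrite (asboolF nX) (asboolT Yx) (asboolF nX'); case: (asboolP (Y y)) => [Yy|nY].
      by have [[_ dx] [_ dy]] := (Yx, Yy); move=> _; apply: (dP x y) => //; rewrite dx.
    case: asboolP => [_ /esym fy0|_ e]; last by have := fW _ Sy nX' nY; rewrite -e ltnn.
    have : 0 < f y; last by rewrite fy0.
    apply: f0 => // Ly; case: Yx => + _; apply.
    by apply: Lle (Ladj _ _ _ (sym _ _ xy) Ly); rewrite /a; lia.
  - by rewrite !asboolF //; apply: fP.
exists g; split.
- move=> x Sx; rewrite /g; case: asboolP => // nX; case: asboolP => [_|nY].
    by case: asboolP.
  by apply: leqW; apply: fK.
- by move=> x y Sx Sy xy /gP; apply.
- move=> x Sx L0; rewrite /g; case: asboolP => [[_ ->]//|nX].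
  rewrite asboolF; first by apply: fc => //; split=> // -[nL _]; apply: nL; apply: Lle L0.
  by case=> nL _; apply: nL; apply: Lle L0.
- move=> x Sx nL; rewrite /g; case: asboolP => // nX; case: asboolP => [_|nY].
    by case: asboolP => // /Lle La1; case: nL; apply: La1; rewrite /a; lia.
  by apply: f0 => // /LK/La.
Qed.

(** * The algorithm *)

Definition near (G : graph) (X : set G) (d : nat) : set G :=
  [set x | exists2 y, X y & dist_le d y x].

Lemma nearS (G : graph) (X : set G) d x :
  near X d.+1 x <-> near X d x \/ exists2 z, near X d z & adj z x.
Proof.
split=> [[y Xy [yx|[z yz zx]]]|[[y Xy yx]|[z [y Xy yz] zx]]].
- by left; exists y.
- by right; exists z => //; exists y.
- by exists y => //; left.
- by exists y => //; right; exists z.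
Qed.

Lemma nearW (G : graph) (X : set G) d d' : d <= d' -> near X d `<=` near X d'.
Proof. by move=> le_d x [y Xy yx]; exists y => //; apply: dist_leW yx. Qed.

Lemma near_sub (G : graph) (X Y : set G) d : X `<=` Y -> near X d `<=` near Y d.
Proof. by move=> XY x [y /XY Yy yx]; exists y. Qed.

(** The greatest vertex is the most significant, as in positional notation with the vertices as
    positions. *)
Definition lexlt (T : Type) (lt : T -> T -> Prop) (c d : T -> nat) : Prop :=
  exists v, c v < d v /\ forall w, lt v w -> c w = d w.

Definition lexmin (T : Type) (lt : T -> T -> Prop) (P : set (T -> nat)) : set (T -> nat) :=
  [set c | P c /\ forall d, P d -> ~ lexlt lt d c].

(** * Existence and uniqueness of lexicographic minima *)

Section FiniteLinear.
Variables (T : Type) (lt : T -> T -> Prop).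
Hypotheses (linT : linear_order lt) (finT : finite_set [set: T]).

Lemma finite_linear_enum : exists l : seq {classic T},
  (forall x : T, (x : {classic T}) \in l) /\
  forall (x0 : {classic T}) i j, i < j -> j < size l -> lt (nth x0 l j) (nth x0 l i).
Proof.
have [irr tr tot] := linT.
have [l lE] : exists l : seq {classic T}, [set: T] = [set` l].
  exact: (@finite_seqP {classic T} _).1 finT.
pose ge (x y : {classic T}) := `[< x = y \/ lt y x >].
have ge_tr : transitive ge.
  move=> y x z /asboolP[->//|yx] /asboolP[<-|zy]; first by apply/asboolP; right.
  by apply/asboolP; right; apply: tr yx.
have ge_tot : total ge.
  move=> x y; have [->|/tot[]] := pselect (x = y).
  - by apply/orP; left; apply/asboolP; left.
  - by move=> xy; apply/orP; right; apply/asboolP; right.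
  - by move=> xy; apply/orP; left; apply/asboolP; right.
exists (sort ge (undup l)); split.
  by move=> x; rewrite mem_sort mem_undup; have : [set: T] x by []; rewrite lE.
move=> x0 i j ij jl; set l' := sort _ _ in jl *.
have := sorted_ltn_nth ge_tr (x0 : {classic T}) (sort_sorted ge_tot (undup l)).
move=> /(_ i j (ltn_trans ij jl) jl ij)/asboolP[/eqP|//].
by rewrite nth_uniq ?sort_uniq ?undup_uniq // ?(ltn_trans ij jl) // ltn_eqF.
Qed.

Lemma finite_linear_max (A : set T) :
  A !=set0 -> exists2 v, A v & forall w, lt v w -> ~ A w.
Proof.
move=> [x1 Ax0]; pose x0 : {classic T} := x1; have [l [lT lP]] := finite_linear_enum.
have [irr tr tot] := linT.
have hasA : has (fun x : {classic T} => `[< A x >]) l.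
  by apply/hasP; exists x0 => //; apply/asboolP.
pose i := find (fun x : {classic T} => `[< A x >]) l.
exists (nth x0 l i); first by apply/asboolP; exact: (nth_find x0 hasA).
move=> w lt_w Aw; have := lT w; rewrite -index_mem => wl.
have wE : nth x0 l (index (w : {classic T}) l) = w by rewrite nth_index ?lT.
case: (ltngtP (index (w : {classic T}) l) i) => [lt_i|lt_i|eq_i].
- by have := before_find x0 lt_i; rewrite wE asboolT.
- have := lP x0 _ _ lt_i wl; rewrite wE => wl'.
  exact: irr (tr _ _ _ lt_w wl').
- by apply: (irr w); rewrite -{1}wE eq_i.
Qed.

Lemma lexmin_uniq (P : set (T -> nat)) c d : lexmin lt P c -> lexmin lt P d -> c = d.
Proof.
move=> [Pc minc] [Pd mind]; apply: funext => x; apply: contrapT => neq_x.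
have [|v neq_v maxv] := @finite_linear_max [set x | c x <> d x]; first by exists x.
have eq_w w : lt v w -> c w = d w by move=> /maxv; apply: contra_notP.
case: (ltngtP (c v) (d v)) => // lt_v; first by apply: mind Pc _; exists v.
by apply: minc Pd _; exists v; split=> // w /eq_w.
Qed.

Lemma lexmin_ex (P : set (T -> nat)) : P !=set0 -> exists c, lexmin lt P c.
Proof.
move=> P0; have [l [lT lP]] := finite_linear_enum.
(* With the vertices listed in decreasing order the claim no longer mentions [lt]. Induction on the
   list then minimizes the value at the head and continues among the functions attaining it. *)
suff: exists2 c, P c & forall d, P d -> forall (x0 : {classic T}) i, i < size l ->
    d (nth x0 l i) < c (nth x0 l i) ->
    (forall j, j < i -> d (nth x0 l j) = c (nth x0 l j)) -> False.
  move=> [c Pc cP]; exists c; split=> // d Pd [v [lt_v eq_v]].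
  have vl : index (v : {classic T}) l < size l by rewrite index_mem lT.
  apply: (cP d Pd v _ vl); first by rewrite nth_index ?lT.
  move=> j lt_j; apply: eq_v; have := lP v _ _ lt_j vl.
  by rewrite nth_index ?lT.
elim: l P P0 {lT lP} => [|v l IHl] P [c0 Pc0]; first by exists c0.
have ex : exists n, `[< exists2 c, P c & c v = n >].
  by exists (c0 v); apply/asboolP; exists c0.
case: (ex_minnP ex) => n /asboolP[c1 Pc1 c1v] minn.
have [|c [Pc cv] cP] := IHl [set c | P c /\ c v = n]; first by exists c1.
exists c => // d Pd x0 [_ /= lt_v _|i lt_i lt_d eq_d].
  have : n <= d v by apply: minn; apply/asboolP; exists d.
  by rewrite -cv leqNgt lt_v.
apply: (cP d _ x0 i) => // [|j lt_j]; last exact: (eq_d j.+1).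
by split=> //; rewrite -cv; apply: (eq_d 0).
Qed.

End FiniteLinear.

Section Stages.
Variables k s : nat.

(* The slack [3 * (k + s)] is what [perfect_extension] needs at any step. *)
Definition rad (j : nat) : nat := (s - j) * (3 * (k + s)).

Section Col.
Variables (G : graph) (lt : G -> G -> Prop) (U : G -> 'I_s.+1).

Definition low (j : nat) : set G := [set x | U x < j].

Lemma lowS j : low j `<=` low j.+1.
Proof. by move=> x; apply: leqW. Qed.

(** Color 0 means uncolored, hence the form of [valid_proper]. For positive [j], the previous step
    colored [low j] up to radius [rad j.-1]; colors are kept only up to [rad j], and the ring in
    between may be recolored. *)
Record valid (j : nat) (c' c : G -> nat) : Prop := Valid {
  valid_old : forall x, near (low j) (rad j) x -> c x = c' x;
  valid_range : forall x, near (low j.+1) (rad j) x -> 0 < c x <= k + j;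
  valid_out : forall x, ~ near (low j.+1) (rad j) x -> c x = 0;
  valid_proper : forall x y, adj x y -> c x = c y -> c x = 0 }.

(** An algorithm must accept every input, including graphs outside the class that admit no valid
    coloring; the constant default is invariant under isomorphism. *)
Definition step (j : nat) (c' : G -> nat) : G -> nat :=
  if pselect (exists c, lexmin lt (valid j c') c) is left e then sval (cid e)
  else fun=> 0.

Fixpoint col (j : nat) : G -> nat :=
  if j is j'.+1 then step j' (col j') else fun=> 0.

Lemma stepP j c' : (exists c, lexmin lt (valid j c') c) ->
  lexmin lt (valid j c') (step j c').
Proof. by move=> e; rewrite /step; case: pselect => // e'; case: cid. Qed.

Lemma step0 j c' : ~ (exists c, lexmin lt (valid j c') c) -> step j c' = fun=> 0.
Proof. by move=> e; rewrite /step; case: pselect. Qed.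

Hypotheses (linG : linear_order lt) (finG : finite_set [set: G]).

Lemma valid0_ex c' : colorable G k -> exists c, valid 0 c' c.
Proof.
move=> [c cP]; pose N := near (low 1) (rad 0).
exists (fun x => if `[< N x >] then (c x).+1 else 0); split.
- by move=> x [y].
- by move=> x Nx; rewrite asboolT // addn0 /=.
- by move=> x Nx; rewrite asboolF.
- move=> x y /cP neq; case: asboolP => // _; case: asboolP => // _ [] eq_c.
  by case: neq; apply: val_inj.
Qed.

Lemma valid_ex j c'' c' : perfect G -> colorable G k -> j < s ->
  valid j c'' c' -> exists c, valid j.+1 c' c.
Proof.
move=> pG [c0 c0P] lt_js [_ rng out prop].
(* As [j < s], the radii [rad j.+1] and [rad j] differ by [3 * (k + s)], so [c'] colors all the
   layers up to [L (3 * (k + j))]. *)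
pose L d := near (low j.+1) (rad j.+1 + d).
have LK x : L (3 * (k + j)) x -> near (low j.+1) (rad j) x.
  by apply: nearW; rewrite /rad; nia.
have [|||||f [fK fP fc f0]] :=
    @perfect_extension G L [set: G] (k + j) c' pG _ _ _ _ _.
- by move=> d; apply: nearW; rewrite leq_add2l.
- by move=> d x y xy Lx; rewrite /L addnS; apply/nearS; right; exists x.
- move=> Q n cQ _ Qn; apply: (@leq_trans k); last exact: leq_addr.
  apply: (@clique_size_le _ _ n k (fun x => c0 x : nat) cQ Qn) => // x y _ _ /c0P neq.
  by move/val_inj.
- by move=> x _ /LK; apply: rng.
- move=> x y _ _ /LK/rng c'x _ xy /(prop _ _ xy) c0x.
  by rewrite c0x in c'x.
pose N := near (low j.+2) (rad j.+1).
(* The extension uses 0 as its additional color, whereas here 0 is reserved for uncolored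
   vertices. *)
pose g x := if f x == 0 then (k + j).+1 else f x.
exists (fun x => if `[< N x >] then g x else 0); split.
- move=> x Nx; have /asboolT-> : N x by apply: near_sub Nx; apply: lowS.
  have L0 : L 0 x by rewrite /L addn0.
  have /rng : near (low j.+1) (rad j) x.
    by apply: LK; apply: nearW L0; rewrite leq_add2l.
  by rewrite /g fc //; case: eqP => // ->.
- move=> x Nx; rewrite asboolT // /g addnS.
  by case: eqP => [_|/eqP]; rewrite ?leqnn // lt0n => -> /=; apply: leqW; apply: fK.
- by move=> x Nx; rewrite asboolF.
- move=> x y xy; case: asboolP => // _; case: asboolP => // _; rewrite /g.
  have := fP x y I I xy; have := fK x I; have := fK y I.
  by case: eqP => [->|_]; case: eqP => [->|_]; lia.
Qed.

Lemma col_lexmin j : perfect G -> colorable G k -> j <= s ->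
  lexmin lt (valid j (col j)) (col j.+1).
Proof.
move=> pG cG; elim: j => [_|j IHj lt_js].
  by apply: stepP; apply: lexmin_ex => //; apply: valid0_ex.
apply: stepP; apply: lexmin_ex => //.
by have [v _] := IHj (ltnW lt_js); apply: valid_ex v.
Qed.

End Col.

(** * Invariance under isomorphism *)

Lemma dist_le_hom (G H : graph) (f : G -> H) d x y :
  graph_hom f -> dist_le d x y -> dist_le d (f x) (f y).
Proof.
move=> homf; elim: d y => [y ->|d IHd y [/IHd|[z /IHd xz /homf zy]]] //; first by left.
by right; exists (f z).
Qed.

Lemma near_iso (G H : graph) (U : G -> 'I_s.+1) (V : H -> 'I_s.+1) (f : G -> H) j d x :
  graph_iso f -> (forall x, U x = V (f x)) ->
  near (low U j) d x <-> near (low V j) d (f x).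
Proof.
move=> [[g fK gK] fE] UV; split=> -[y Uy yx].
  exists (f y); first by rewrite /low /= -UV.
  by apply: dist_le_hom yx => u v /fE.
exists (g y); first by rewrite /low /= UV gK.
by rewrite -(fK x); apply: dist_le_hom yx => u v; rewrite fE !gK.
Qed.

Lemma valid_iso (G H : graph) (U : G -> 'I_s.+1) (V : H -> 'I_s.+1) (f : G -> H) j c' c :
  graph_iso f -> (forall x, U x = V (f x)) ->
  valid V j c' c -> valid U j (c' \o f) (c \o f).
Proof.
move=> isof UV [old rng out prop]; have nf i d x := near_iso i d x isof UV.
split=> [x /nf/old//|x /nf/rng//|x /nf/out//|x y xy].
by apply: prop; apply/isof.2.
Qed.

Lemma lexlt_iso (T V : Type) (lt : T -> T -> Prop) (lt' : V -> V -> Prop) (f : T -> V) c d :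
  bijective f -> (forall x y, lt x y <-> lt' (f x) (f y)) ->
  lexlt lt (c \o f) (d \o f) <-> lexlt lt' c d.
Proof.
move=> [g fK gK] fE; split=> -[v [lt_v eq_v]].
  by exists (f v); split=> // w; rewrite -[w]gK => /fE/eq_v.
exists (g v); rewrite /= gK; split=> // w /fE; rewrite gK => /eq_v //.
Qed.

(** Lexicographic minima are transported in both directions and are unique; if one side has none,
    neither has the other, and both take the default. *)
Lemma col_iso (G H : graph) (U : G -> 'I_s.+1) (V : H -> 'I_s.+1)
    (lt : G -> G -> Prop) (lt' : H -> H -> Prop) (f : G -> H) j :
  graph_iso f -> (forall x, U x = V (f x)) ->
  (forall x y, lt x y <-> lt' (f x) (f y)) ->
  linear_order lt -> finite_set [set: G] ->
  col lt U j = col lt' V j \o f.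
Proof.
move=> isof UV ltE linG finG; have [[g fK gK] fE] := isof.
have isog : graph_iso g.
  by split; [exists f | move=> x y; rewrite fE !gK].
have VU x : V x = U (g x) by rewrite UV gK.
have fgK (c : H -> nat) : c \o f \o g = c by apply: funext => x /=; rewrite gK.
have gfK (c : G -> nat) : c \o g \o f = c by apply: funext => x /=; rewrite fK.
have bf : bijective f by exists g.
elim: j => //= j IHj.
have min_iso c : lexmin lt' (valid V j (col lt' V j)) c ->
    lexmin lt (valid U j (col lt U j)) (c \o f).
  move=> [vc minc]; split; first by rewrite IHj; apply: valid_iso vc.
  move=> d vd; rewrite -[d]gfK (lexlt_iso _ _ bf ltE); apply: minc.
  by rewrite -[col _ _ _]fgK -IHj; apply: valid_iso vd.
have min_iso' c : lexmin lt (valid U j (col lt U j)) c ->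
    lexmin lt' (valid V j (col lt' V j)) (c \o g).
  move=> [vc minc]; split.
    by rewrite -[col _ _ _]fgK -IHj; apply: valid_iso vc.
  move=> d vd; rewrite -(lexlt_iso _ _ bf ltE) gfK; apply: minc.
  by rewrite IHj; apply: valid_iso vd.
have [e|ne] := pselect (exists c, lexmin lt' (valid V j (col lt' V j)) c).
  have m' := min_iso _ (stepP e).
  by apply: (lexmin_uniq linG finG _ m'); apply: stepP; eexists; exact: m'.
rewrite (step0 ne) step0 // => -[c /min_iso' m].
by apply: ne; eexists; exact: m.
Qed.

(** The predecessor moves the final colors [1, ..., k + s] into the von Neumann ordinal [k + s]. *)
Fact asi_run_iso (I J : asi_input s) (f : I -> J) (isof : input_iso f)
    (x : {x : I | input_target I x}) :
  hf_nat (col (@input_lt s I) (@input_part s I) s.+1 (sval x)).-1 =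
  hf_nat (col (@input_lt s J) (@input_part s J) s.+1 (f (sval x))).-1.
Proof.
congr (hf_nat _.-1); case: isof => isof ltE UV _.
by rewrite (col_iso s.+1 isof UV ltE (input_linear I) (input_finite I)).
Qed.

Definition perfect_algorithm : asi_algorithm s := AsiAlgorithm asi_run_iso.

End Stages.

(** * Locality *)

Section Locality.
Variables (k s r : nat) (G : graph) (lt : G -> G -> Prop) (U : G -> 'I_s.+1).
Hypothesis linG : linear_order lt.
(** Two vertices of [U_j] whose neighborhoods of radius [rad k s j] are joined by an edge are at
    distance at most [r], hence in the same cluster. *)
Hypothesis le_rad : forall j, rad k s j + 1 + rad k s j <= r.

Lemma cluster_of_dist x y : dist_le r x y ->
  dist_le 1 (cluster_of r U x) (cluster_of r U y).
Proof.
move=> xy; have [->|neq] := pselect (cluster_of r U x = cluster_of r U y).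
  exact: dist_le_refl.
apply: dist_le_adj; split=> //.
by exists x, y; split=> //; apply: cluster_of_mem.
Qed.

Lemma cluster_of_eq x y : U x = U y -> dist_le r x y ->
  cluster_of r U x = cluster_of r U y.
Proof.
move=> Uxy xy; have [->//|neq] := pselect (x = y).
apply: cluster_ofE; exists (exist (part U (U x)) y (esym Uxy)) => //.
exists 1; apply: dist_le_adj.
by split=> //= e.
Qed.

(** Brings colorings of different windows to the common domain [G], where they can be compared. *)
Definition extend (S : set G) (a : induced S -> nat) (x : G) : nat :=
  if pselect (S x) is left Sx then a (exist _ x Sx) else 0.

Lemma extendE (S : set G) (a : induced S -> nat) (x : induced S) :
  extend a (sval x) = a x.
Proof.
case: x => x Sx; rewrite /extend /=; case: pselect => // Sx'.
by congr a; apply: eq_exist.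
Qed.

Local Notation part_on S := (fun x : induced S => U (sval x)).
Local Notation lt_on S := (fun x y : induced S => lt (sval x) (sval y)).

(** A path of length at most [d] ending at [x] stays in the ball of radius [d] around [x], hence in
    [S]. *)
Lemma near_induced (S : set G) j d (x : induced S) :
  (forall y, dist_le d (sval x) y -> S y) ->
  near (low (part_on S) j) d x <-> near (low U j) d (sval x).
Proof.
move=> dS; split=> [[y Uy yx]|[y Uy yx]].
  by exists (sval y) => //; apply: (@dist_le_hom (induced S) G sval).
elim: d x dS yx => [x dS yx|d IHd [x Sx] dS /= [yx|[z yz zx]]].
- by exists x => //=; rewrite /low /= -yx.
- apply: nearW (leqnSn d) _ _; apply: IHd => // z xz; apply: dS.
  exact: dist_leW xz.
have xz : dist_le 1 x z by apply: dist_le_adj; apply: adj_sym.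
have Sz : S z by apply: dS; apply: dist_leW xz.
apply/nearS; right; exists (exist _ z Sz) => //; apply: IHd => //= t zt.
by apply: dS; rewrite -add1n; apply: dist_le_trans zt.
Qed.

(* [deep t x] stands for: the clusters at distance at most [t] from that of [x]
   are contained in both windows. *)
Section TwoWindows.
Variables (S S' : set G) (deep : nat -> set G) (j : nat) (P : set G).
Variables (c a : induced S -> nat) (c' a' : induced S' -> nat).
Hypotheses (dS : forall t, deep t `<=` S) (dS' : forall t, deep t `<=` S').
Hypothesis dstep : forall t x y, deep t.+1 x -> dist_le r x y -> deep t y.
Hypothesis va : valid k (part_on S) j c a.
Hypothesis ma' : lexmin (lt_on S') (valid k (part_on S') j c') a'.
Hypothesis eq_c : forall x, deep (3 * j + 1) x -> extend c x = extend c' x.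
Hypothesis Pdeep : P `<=` deep (3 * j + 2).
Hypothesis Pnew : forall x, P x ->
  near (low U j.+1) (rad k s j) x /\ ~ near (low U j) (rad k s j) x.
Hypothesis Padj : forall x y, P x -> adj x y ->
  near (low U j.+1) (rad k s j) y -> ~ near (low U j) (rad k s j) y -> P y.

Let r_gt0 : 1 <= r. Proof. by apply: leq_trans (le_rad j); lia. Qed.
Let rad_r : rad k s j <= r. Proof. by apply: leq_trans (le_rad j); lia. Qed.

Let deep_near t i x (Sx : S x) : deep t.+1 x ->
  near (low (part_on S) i) (rad k s j) (exist _ x Sx) <-> near (low U i) (rad k s j) x.
Proof.
move=> dx; apply: (@near_induced S i _ (exist _ x Sx)) => y xy.
exact: (dS (dstep dx (dist_leW rad_r xy))).
Qed.

Let deep_near' t i x (Sx : S' x) : deep t.+1 x ->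
  near (low (part_on S') i) (rad k s j) (exist _ x Sx) <-> near (low U i) (rad k s j) x.
Proof.
move=> dx; apply: (@near_induced S' i _ (exist _ x Sx)) => y xy.
exact: (dS' (dstep dx (dist_leW rad_r xy))).
Qed.

(* Replacing [a'] by [a] on [P] yields another admissible coloring of [S']. *)
Lemma lexmin_swap v : P v -> extend a v < extend a' v ->
  (forall w, P w -> lt v w -> extend a w = extend a' w) -> False.
Proof.
move=> Pv lt_v eq_w; have [va' mina'] := ma'.
pose b (x : induced S') := if `[< P (sval x) >] then extend a (sval x) else a' x.
apply: (mina' b); last first.
  exists (exist _ v (dS' (Pdeep Pv))); split; first by rewrite /b asboolT //= -extendE.
  by move=> w /= vw; rewrite /b; case: asboolP => // Pw; rewrite eq_w // extendE.
have bP (x y : induced S') : P (sval x) -> adj x y -> b x = b y -> b x = 0.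
  move=> Px xy; rewrite /b asboolT //.
  have dx := Pdeep Px; have Sx := dS dx.
  have dy : deep (3 * j + 1) (sval y).
    have dx1 : deep (3 * j + 1).+1 (sval x) by rewrite -addn1 -addnA.
    by apply: dstep dx1 _; apply: dist_leW r_gt0 (@dist_le_adj G _ _ xy).
  have dy0 : deep (3 * j).+1 (sval y) by rewrite -addn1.
  have Sy := dS dy.
  pose x1 : induced S := exist _ (sval x) Sx; pose y1 : induced S := exist _ (sval y) Sy.
  have prop := valid_proper va (x := x1) (y := y1) xy.
  have ax1 : extend a (sval x) = a x1 := extendE a x1.
  have ay1 : extend a (sval y) = a y1 := extendE a y1.
  rewrite ax1; case: asboolP => [Py|nPy]; first by rewrite ay1; exact: prop.
  (* An edge leaving [P] ends, by [Padj], either in a kept vertex, where both windows agree by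
     [eq_c], or in an uncolored one. *)
  have [ny|ny] := pselect (near (low U j) (rad k s j) (sval y)).
    suff -> : a' y = a y1 by exact: prop.
    have ny1 : near (low (part_on S) j) (rad k s j) y1 by apply/(deep_near _ _ dy0).
    have ny' : near (low (part_on S') j) (rad k s j) y.
      by case: (y) ny dy0 => z S'z /= nz dz; apply/(deep_near' _ _ dz).
    rewrite (valid_old va ny1) (valid_old va' ny') -!extendE /=.
    exact/esym/eq_c.
  have [ny2|ny2] := pselect (near (low U j.+1) (rad k s j) (sval y)).
    by case: nPy; apply: (Padj Px xy).
  move=> ->; apply: (valid_out va').
  by case: (y) ny2 dy0 => z S'z /= nz dz; apply: contra_not nz => /(deep_near' _ _ dz).
split=> [x nx|x nx|x nx|x y xy].
- rewrite /b; case: asboolP => [Px|_]; last exact: (valid_old va' nx).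
  case: x Px nx => x S'x /= Px nx; have [_ []] := Pnew Px.
  by have := Pdeep Px; rewrite addn2 => dx; apply/(deep_near' _ S'x dx).
- rewrite /b; case: asboolP => [Px|_]; last exact: (valid_range va' nx).
  have := Pdeep Px; rewrite addn2 => dx.
  rewrite (extendE a (exist _ (sval x) (dS dx))); apply: (valid_range va).
  by apply/(deep_near _ _ dx); case: (Pnew Px).
- rewrite /b; case: asboolP => [Px|_]; last exact: (valid_out va' nx).
  case: nx; case: x Px => x S'x /= Px.
  by have := Pdeep Px; rewrite addn2 => dx; apply/(deep_near' _ S'x dx); case: (Pnew Px).
have [Px|nPx] := pselect (P (sval x)); first exact: bP.
have [Py|nPy] := pselect (P (sval y)).
  by move=> bxy; rewrite bxy; apply: (bP y x) => //; apply: (@adj_sym (induced S')).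
by rewrite /b !asboolF //; apply: (valid_proper va').
Qed.

End TwoWindows.

Hypotheses (pG : perfect G) (colG : colorable G k).

Lemma colorable_induced (S : set G) : colorable (induced S) k.
Proof. exact: (@colorable_hom (induced S) G sval k _ colG). Qed.

Local Notation col_on S := (col k (lt_on S) (part_on S)).

(** Each step spends three layers of clusters: from [x] to a vertex [u0] of [U_j] near it, from the
    cluster of [u0] to the vertices around it, and from these to their neighbors, where the
    induction hypothesis applies. The last layer lets nearness be tested inside the windows. *)
Lemma col_local (S S' : set G) (deep : nat -> set G) :
  finite_set [set: induced S] -> finite_set [set: induced S'] ->
  (forall t, deep t `<=` S) -> (forall t, deep t `<=` S') ->
  (forall t x y, deep t.+1 x -> dist_le r x y -> deep t y) ->
  (forall t x y, cluster_of r U x = cluster_of r U y -> deep t x -> deep t y) ->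
  forall j x, j <= s.+1 -> deep (3 * j + 1) x ->
    extend (col_on S j) x = extend (col_on S' j) x.
Proof.
move=> finI finI' dS dS' dstep dclus; elim=> [|j IHj] x lt_j dx.
  by rewrite /extend; do 2!case: pselect => // ?.
have rad_r : rad k s j <= r by apply: leq_trans (le_rad j); lia.
have minS := @col_lexmin k s _ _ (part_on S) (induced_linear linG S) finI j
  (perfect_induced pG) (colorable_induced S) lt_j.
have minS' := @col_lexmin k s _ _ (part_on S') (induced_linear linG S') finI' j
  (perfect_induced pG) (colorable_induced S') lt_j.
set a := col_on S j.+1 in minS *; set a' := col_on S' j.+1 in minS' *.
have [va _] := minS; have [va' _] := minS'.
have dlow t y m : t <= m -> deep m y -> deep t y.
  move=> /subnKC<-; elim: (m - t) => [|i IHi]; rewrite ?addn0 ?addnS //.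
  by move=> dy; apply: IHi; apply: dstep dy _; apply: dist_le_refl.
have dx1 : deep 1 x by apply: dlow dx; lia.
have Sx := dS _ _ dx1; have S'x := dS' _ _ dx1.
have nx i := @near_induced S i (rad k s j) (exist _ x Sx)
  (fun y xy => dS 0 y (dstep _ _ _ dx1 (dist_leW rad_r xy))).
have nx' i := @near_induced S' i (rad k s j) (exist _ x S'x)
  (fun y xy => dS' 0 y (dstep _ _ _ dx1 (dist_leW rad_r xy))).
rewrite (extendE a (exist _ x Sx)) (extendE a' (exist _ x S'x)).
have [oldx|nold] := pselect (near (low U j) (rad k s j) x).
  rewrite (valid_old va) ?(valid_old va'); [|exact/nx'|exact/nx].
  rewrite -!extendE /=; apply: IHj; first exact: leqW.
  by apply: dlow dx; lia.
have [newx|nnew] := pselect (near (low U j.+1) (rad k s j) x); last first.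
  by rewrite (valid_out va) ?(valid_out va') // => [/nx'|/nx].
have newP y : near (low U j.+1) (rad k s j) y -> ~ near (low U j) (rad k s j) y ->
    exists2 u, U u = j :> nat & dist_le (rad k s j) u y.
  move=> [u Uu uy] ny; exists u => //; apply/eqP; rewrite eqn_leq -ltnS Uu leqNgt.
  by apply/negP => lt_u; apply: ny; exists u.
have [u0 Uu0 u0x] := newP _ newx nold.
have du0 : deep (3 * j + 3) u0.
  apply: dstep (dist_leW rad_r (dist_le_sym u0x)); apply: dlow dx; lia.
(* Only the new vertices around the cluster of [u0]: by [le_rad], no edge joins them to new vertices
   around another cluster, which gives [Padj]. *)
pose P := [set y | ~ near (low U j) (rad k s j) y /\ exists u,
  [/\ U u = j :> nat, cluster_of r U u0 = cluster_of r U u & dist_le (rad k s j) u y]].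
have Pdeep : P `<=` deep (3 * j + 2).
  move=> y [_ [u [Uu u0u uy]]]; have := dclus _ _ _ u0u du0; rewrite addnS => du.
  exact: dstep du (dist_leW rad_r uy).
have Pnew y : P y -> near (low U j.+1) (rad k s j) y /\ ~ near (low U j) (rad k s j) y.
  by move=> [ny [u [Uu _ uy]]]; split=> //; exists u => //; rewrite /low /= Uu.
have Padj y z : P y -> adj y z -> near (low U j.+1) (rad k s j) z ->
    ~ near (low U j) (rad k s j) z -> P z.
  move=> [ny [u [Uu u0u uy]]] yz nz nz'; split=> //.
  have [u' Uu' u'z] := newP _ nz nz'; exists u'; split=> //; rewrite u0u.
  apply: cluster_of_eq; first by apply: ord_inj; rewrite Uu Uu'.
  apply: dist_leW (le_rad j) _; apply: dist_le_trans (dist_le_sym u'z).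
  exact: dist_le_trans uy (dist_le_adj yz).
have Px : P x by split=> //; exists u0.
apply: contrapT; rewrite -!extendE /= => neq_x.
have [|v [Pv neq_v] maxv] := @finite_linear_max _ _ (induced_linear linG S) finI
    [set y : induced S | P (sval y) /\ extend a (sval y) <> extend a' (sval y)].
  by exists (exist _ x Sx).
have eq_w w : P w -> lt (sval v) w -> extend a w = extend a' w.
  move=> Pw vw; apply: contrapT => neq_w.
  by apply: (maxv (exist _ w (dS _ _ (Pdeep _ Pw)))).
(* At the greatest disagreement [v] in [P], the window with the larger color is not minimal; the two
   cases exchange the windows. *)
case: (ltngtP (extend a (sval v)) (extend a' (sval v))) => // lt_v.
  apply: (@lexmin_swap S S' deep j P _ _ _ _ dS dS' dstep va minS' _
    Pdeep Pnew Padj _ Pv lt_v).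
    by move=> y dy; apply: IHj => //; apply: leqW.
  exact: eq_w.
apply: (@lexmin_swap S' S deep j P _ _ _ _ dS' dS dstep va' minS _
  Pdeep Pnew Padj _ Pv lt_v).
  by move=> y dy; apply/esym/IHj => //; apply: leqW.
by move=> w Pw vw; rewrite eq_w.
Qed.

End Locality.

(** Twice the largest radius [rad k s 0], plus one edge. *)
Definition run_scale (k s : nat) : nat := 2 * (s * (3 * (k + s))) + 1.
(** Agreement after [s + 1] steps needs depth [3 * s.+1 + 1]; one more layer passes from the window
    of a vertex to that of a neighbor. *)
Definition run_range (s : nat) : nat := 3 * s.+1 + 2.

Lemma run_on_proper (k s : nat) (G : graph) (GP : perfect_class k G)
    (lt : G -> G -> Prop) (linG : linear_order lt)
    (U : G -> 'I_s.+1) (wU : asi_witness (run_scale k s) U) :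
  proper_coloring (k + s)
    (run_on (perfect_class_lf GP) wU linG (perfect_algorithm k s) (run_range s)).
Proof.
have [lfG colG pG] := GP.
set r := run_scale k s in wU *; set n := run_range s.
have le_rad j : rad k s j + 1 + rad k s j <= r.
  by rewrite /rad /r /run_scale; have := leq_subr j s; nia.
pose W v := window n (cluster_of r U v).
pose cW v := col k (fun x y : induced (W v) => lt (sval x) (sval y))
  (fun x : induced (W v) => U (sval x)) s.+1.
have Wv v : W v v by apply: window_mem.
have -> : run_on (perfect_class_lf GP) wU linG (perfect_algorithm k s) n =
    fun v => hf_nat (extend (cW v) v).-1.
  by apply: funext => v; rewrite (extendE (cW v) (exist _ v (Wv v)));
    congr (hf_nat (cW v _).-1); apply: eq_exist.
have finW v : finite_set [set: induced (W v)].
  exact: (induced_window_finite (perfect_class_lf GP) wU).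
have val_cW v : valid k (fun x : induced (W v) => U (sval x)) s
    (col k (fun x y : induced (W v) => lt (sval x) (sval y))
      (fun x : induced (W v) => U (sval x)) s) (cW v).
  by have [] := @col_lexmin k s _ _ (fun x : induced (W v) => U (sval x))
    (induced_linear linG (W v)) (finW v) s (perfect_induced pG)
    (colorable_induced colG (W v)) (leqnn s).
(* Every vertex is in some part, so [low s.+1] is everything and no vertex stays uncolored. *)
have rng v (x : induced (W v)) : 0 < cW v x <= k + s.
  apply: (valid_range (val_cW v)); exists x; last exact: dist_le_refl.
  exact: (ltn_ord (U (sval x))).
split=> [x|x y xy].
  have := rng x (exist _ x (Wv x)); rewrite -extendE /= => /andP[c_gt0 le_c].
  by exists (extend (cW x) x).-1; rewrite ?prednK.
pose deep t z := forall y', dist_le t (cluster_of r U z) (cluster_of r U y') ->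
  W x y' /\ W y y'.
have dxy : dist_le 1 (cluster_of r U x) (cluster_of r U y).
  apply: cluster_of_dist; apply: dist_leW (dist_le_adj xy).
  by rewrite /r /run_scale addn1.
have dy : deep (3 * s.+1 + 1) y.
  move=> z yz; split; exists (cluster_of r U z) => //; try exact: cluster_of_mem.
    have := dist_le_trans dxy yz; congr dist_le; rewrite /n /run_range; lia.
  by apply: dist_leW yz; rewrite /n /run_range; lia.
have dW t z : deep t z -> W x z /\ W y z by move=> /(_ z); apply; apply: dist_le_refl.
have [Wxy _] := dW _ _ dy.
(* Both ends of the edge can now be read in the window of [x], on which the coloring is proper. *)
have eq_y : extend (cW x) y = extend (cW y) y.
  apply: (@col_local k s r G lt U linG le_rad pG colG (W x) (W y) deep) => //.
  - by move=> t z /dW[].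
  - by move=> t z /dW[].
  - move=> t u v du uv z vz; apply: du; rewrite -add1n.
    exact: dist_le_trans (cluster_of_dist U uv) vz.
  - by move=> t u v uv du z; rewrite -uv; apply: du.
move=> /hf_nat_inj; rewrite -eq_y (extendE (cW x) (exist _ x (Wv x))).
rewrite (extendE (cW x) (exist _ y Wxy)).
have := rng x (exist _ x (Wv x)); have := rng x (exist _ y Wxy).
have := valid_proper (val_cW x) (x := exist _ x (Wv x)) (y := exist _ y Wxy) xy.
lia.
Qed.

(** * Computability *)

Section Digits.
Variable b : nat.
Hypothesis b_gt0 : 0 < b.

Definition digit (a i : nat) : nat := (a %/ b ^ i) %% b.

Fixpoint undigit (m : nat) (c : nat -> nat) : nat :=
  if m is m'.+1 then undigit m' c + c m' * b ^ m' else 0.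

Lemma digit_addl a q m i : i < m -> digit (a + q * b ^ m) i = digit a i.
Proof.
move=> lt_im; rewrite /digit -(subnK (ltnW lt_im)) expnD mulnA divnDMl ?expn_gt0 ?b_gt0 //.
by rewrite -(@prednK (m - i)) ?subn_gt0 // expnS mulnCA addnC [b * _]mulnC modnMDl.
Qed.

Lemma undigit_lt m c : (forall i, i < m -> c i < b) -> undigit m c < b ^ m.
Proof.
elim: m => [|m IHm] cb; first by rewrite expn0.
have {}IHm : undigit m c < b ^ m by apply: IHm => i lt_i; apply: cb; apply: ltnW.
by rewrite /= expnS; have := cb m (ltnSn m); nia.
Qed.

Lemma digit_undigit m c i : (forall i, i < m -> c i < b) -> i < m ->
  digit (undigit m c) i = c i.
Proof.
elim: m => // m IHm cb; have cb' j : j < m -> c j < b by move=> /ltnW/cb.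
rewrite ltnS leq_eqVlt => /orP[/eqP->|lt_i] /=; last by rewrite digit_addl // IHm.
rewrite /digit addnC divnMDl ?expn_gt0 ?b_gt0 // divn_small ?addn0 ?undigit_lt //.
by rewrite modn_small // cb.
Qed.

Lemma eq_undigit m c d : (forall i, i < m -> c i = d i) -> undigit m c = undigit m d.
Proof.
elim: m => //= m IHm eq_cd; rewrite eq_cd // IHm // => i lt_i.
by apply: eq_cd; apply: ltnW.
Qed.

Lemma undigit_digit m a : a < b ^ m -> undigit m (digit a) = a.
Proof.
elim: m a => [|m IHm] a lt_a /=; first by move: lt_a; rewrite expn0 ltnS leqn0 => /eqP.
have bm : 0 < b ^ m by rewrite expn_gt0 b_gt0.
rewrite (@eq_undigit m _ (digit (a %% b ^ m))) => [|i lt_i]; last first.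
  by rewrite {1}(divn_eq a (b ^ m)) addnC digit_addl.
rewrite IHm ?ltn_mod // /digit (modn_small (_ : a %/ b ^ m < b)).
  by rewrite addnC -divn_eq.
by rewrite ltn_divLR // -expnS.
Qed.

(** The digits of [c] below [v] total less than [b ^ v], the least gain at [v]. So a numerically
    least code is also lexicographically least. *)
Lemma undigit_lex m c d v : (forall i, i < m -> c i < b) -> v < m -> c v < d v ->
  (forall w, v < w -> w < m -> c w = d w) -> undigit m c < undigit m d.
Proof.
elim: m => // m IHm cb; have cb' j : j < m -> c j < b by move=> /ltnW/cb.
rewrite ltnS leq_eqVlt => /orP[/eqP-> lt_v _|lt_v lt_c eq_c] /=.
  by have := undigit_lt cb'; nia.
rewrite eq_c // ltn_add2r; apply: IHm => // w vw /ltnW; exact: eq_c.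
Qed.

End Digits.

(** Tuples nest to the right and the last entry is not wrapped in a pair, hence the strict bound and
    the separate treatment of the last entry. *)
Lemma hf_tuple_fst i x l : i < size l ->
  hf_fst (iter i hf_snd (hf_tuple x l)) = nth 0 (x :: l) i.
Proof.
elim: i x l => [|i IHi] x [|y l] // lt_i; first by rewrite /= hf_fstE.
by rewrite iterSr [hf_tuple _ _]/= hf_sndE IHi.
Qed.

Lemma hf_tuple_last x l : iter (size l) hf_snd (hf_tuple x l) = last x l.
Proof.
by elim: l x => // y l IHl x; rewrite [size _]/= iterSr [hf_tuple _ _]/= hf_sndE IHl.
Qed.

Lemma leq_hf_nat n : n <= hf_nat n.
Proof.
elim: n => // n IHn; apply: leq_ltn_trans IHn _; apply: hf_mem_lt.
by rewrite /= hf_mem_insert eqxx.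
Qed.

(** * The algorithm on codes *)

Section Decode.
Variables k s : nat.
Local Notation b := (k + s).+1.

Definition code_vertices (w : HF) : HF := hf_fst (hf_fst w).
Definition code_edges (w : HF) : HF := hf_snd (hf_fst w).
(** Entries 0 and 1 of the input tuple are the graph and the order, hence the shift by 2. *)
Definition code_part (i : nat) (w : HF) : HF := hf_fst (iter i.+2 hf_snd w).
Definition code_target (w : HF) : HF := iter s.+3 hf_snd w.

Definition code_size (w : HF) : nat :=
  bmin (code_vertices w).+1 (fun x => hf_nat x == code_vertices w).

Definition code_adj (w : HF) (x y : nat) : bool :=
  hf_mem (hf_pair (hf_nat x) (hf_nat y)) (code_edges w).

(** The step [j], and below the radius [d], are bounded in terms of [k] and [s] alone. Recursion on
    them stays at the meta level and unfolds into finitely many compositions. *)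
Fixpoint code_low (j : nat) (w : HF) (x : nat) : bool :=
  if j is j'.+1 then code_low j' w x || hf_mem (hf_nat x) (code_part j' w) else false.

Fixpoint code_near (j d : nat) (w : HF) (x : nat) : bool :=
  if d is d'.+1 then code_near j d' w x ||
    exb (code_size w) (fun z => code_near j d' w z && code_adj w z x)
  else code_low j w x.

Definition code_valid (j : nat) (w : HF) (a' a : nat) : bool :=
  allb (code_size w) (fun x =>
    [&& code_near j (rad k s j) w x ==> (digit b a x == digit b a' x),
        code_near j.+1 (rad k s j) w x ==> (0 < digit b a x) && (digit b a x <= k + j),
        ~~ code_near j.+1 (rad k s j) w x ==> (digit b a x == 0) &
        allb (code_size w) (fun y => code_adj w x y ==>
          (digit b a x == digit b a y) ==> (digit b a x == 0))]).

(* When no coloring is admissible, the search returns [b ^ m], whose first [m]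
   digits are 0. *)
Fixpoint code_col (j : nat) (w : HF) : nat :=
  if j is j'.+1 then bmin (b ^ code_size w) (code_valid j' w (code_col j' w)) else 0.

Definition code_output (w : HF) : HF :=
  nat_rect (fun=> nat) 0 (fun x o =>
    if hf_mem (hf_nat x) (code_target w)
    then hf_insert (hf_pair (hf_nat x) (hf_nat (digit b (code_col s.+1 w) x).-1)) o
    else o) (code_size w).

Lemma rec_iter_snd i F : rec F -> rec (fun e => iter i hf_snd (F e)).
Proof. by move=> rF; elim: i => //= i IHi; apply: rec_hf_snd. Qed.

Lemma rec_code_vertices F : rec F -> rec (fun e => code_vertices (F e)).
Proof. by move=> rF; do 2!apply: rec_hf_fst. Qed.

Lemma rec_code_size F : rec F -> rec (fun e => code_size (F e)).
Proof.
apply: (@rec1 code_size); have r0 := rec_code_vertices (rec_var 0).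
apply: (@rec_bmin _ (fun e x => hf_nat x == code_vertices (head 0 e))).
  exact: rec_succ.
apply: recb_eq; first by apply: rec_hf_nat; exact: (rec_var 0).
by apply: rec_code_vertices; exact: (rec_var 1).
Qed.

Lemma recb_code_adj F X Y : rec F -> rec X -> rec Y ->
  recb (fun e => code_adj (F e) (X e) (Y e)).
Proof.
move=> rF rX rY; apply: recb_hf_mem.
  by apply: rec_hf_pair; apply: rec_hf_nat.
by apply: rec_hf_snd; apply: rec_hf_fst.
Qed.

Lemma recb_code_low j F X : rec F -> rec X -> recb (fun e => code_low j (F e) (X e)).
Proof.
move=> rF rX; elim: j => [|j IHj]; first exact: (rec_cst 0).
apply: recb_or => //; apply: recb_hf_mem; first exact: rec_hf_nat.
by apply: rec_hf_fst; apply: (@rec_iter_snd j.+2).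
Qed.

Lemma recb_code_near j d F X : rec F -> rec X ->
  recb (fun e => code_near j d (F e) (X e)).
Proof.
(* Passing to variables before the induction makes the hypothesis usable under the binder of [z]. *)
apply: (@recb2 (code_near j d)).
elim: d => [|d IHd].
  by apply: recb_code_low; [exact: (rec_var 0)|exact: (rec_var 1)].
apply: recb_or => //.
apply: (@recb_ex _ (fun e z => code_near j d (head 0 e) z &&
  code_adj (head 0 e) z (head 0 (behead e)))).
  by apply: rec_code_size; exact: (rec_var 0).
apply: recb_and.
  apply: (@recb2 (code_near j d) _ _ IHd).
    exact: (rec_var 1).
  exact: (rec_var 0).
by apply: recb_code_adj; [exact: (rec_var 1)|exact: (rec_var 0)|exact: (rec_var 2)].
Qed.

Lemma rec_digit F X : rec F -> rec X -> rec (fun e => digit b (F e) (X e)).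
Proof.
move=> rF rX; apply: rec_mod; last exact: rec_cst.
by apply: rec_div => //; apply: rec_exp => //; apply: rec_cst.
Qed.

Lemma recb_code_valid j F A' A : rec F -> rec A' -> rec A ->
  recb (fun e => code_valid j (F e) (A' e) (A e)).
Proof.
apply: (@recb3 (code_valid j)).
apply: (@recb_all _ (fun e x => let w := head 0 e in
  let a' := head 0 (behead e) in let a := head 0 (behead (behead e)) in
    [&& code_near j (rad k s j) w x ==> (digit b a x == digit b a' x),
        code_near j.+1 (rad k s j) w x ==> (0 < digit b a x) && (digit b a x <= k + j),
        ~~ code_near j.+1 (rad k s j) w x ==> (digit b a x == 0) &
        allb (code_size w) (fun y => code_adj w x y ==>
          (digit b a x == digit b a y) ==> (digit b a x == 0))])).
  by apply: rec_code_size; exact: (rec_var 0).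
have rx := rec_var 0; have rw := rec_var 1; have ra' := rec_var 2.
have ra := rec_var 3.
have r0 := rec_cst 0.
apply: recb_and.
  apply: recb_imply; first exact: recb_code_near.
  by apply: recb_eq; apply: rec_digit.
apply: recb_and.
  apply: recb_imply; first exact: recb_code_near.
  apply: recb_and; apply: recb_leq.
  - exact: (rec_cst 1).
  - exact: rec_digit.
  - exact: rec_digit.
  - exact: rec_cst.
apply: recb_and.
  apply: recb_imply; first by apply: recb_neg; apply: recb_code_near.
  by apply: recb_eq => //; apply: rec_digit.
apply: (@recb_all _ (fun e y => let x := head 0 e in let w := head 0 (behead e) in
  let a := head 0 (behead (behead (behead e))) in code_adj w x y ==>
    (digit b a x == digit b a y) ==> (digit b a x == 0))).
  exact: rec_code_size.
have {}rx := rec_var 1; have ry := rec_var 0.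
have {}rw := rec_var 2; have {}ra := rec_var 4.
apply: recb_imply; first exact: recb_code_adj.
by apply: recb_imply; apply: recb_eq => //; apply: rec_digit.
Qed.

Lemma rec_code_col j F : rec F -> rec (fun e => code_col j (F e)).
Proof.
apply: (@rec1 (code_col j)); elim: j => [|j IHj]; first exact: rec_cst.
apply: (@rec_bmin _ (fun e a =>
  code_valid j (head 0 e) (code_col j (head 0 e)) a)).
  by apply: rec_exp; [exact: rec_cst|apply: rec_code_size; exact: (rec_var 0)].
apply: recb_code_valid; [exact: (rec_var 1)| |exact: (rec_var 0)].
by apply: (@rec1 (code_col j) _ IHj); exact: (rec_var 1).
Qed.

Lemma rec_code_output : rec (fun e => code_output (head 0 e)).
Proof.
apply: (@rec_prim _ _ (fun e x o =>
    if hf_mem (hf_nat x) (code_target (head 0 e))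
    then hf_insert (hf_pair (hf_nat x)
      (hf_nat (digit b (code_col s.+1 (head 0 e)) x).-1)) o
    else o)).
- by apply: rec_code_size; exact: (rec_var 0).
- exact: rec_cst.
have rx := rec_var 0; have ro := rec_var 1; have rw := rec_var 2.
apply: rec_if => //.
  by apply: recb_hf_mem; [exact: rec_hf_nat|exact: (@rec_iter_snd s.+3)].
apply: rec_hf_insert => //; apply: rec_hf_pair; first exact: rec_hf_nat.
by apply: rec_hf_nat; apply: rec_pred; apply: rec_digit => //; apply: rec_code_col.
Qed.

(** * Correctness on canonical inputs *)

Section Correct.
Variable J : canonical_input s.
Local Notation m := (can_size J).
Local Notation V := 'I_m.
Local Notation w := (input_code J).
Local Notation H := (input_of_canonical J).

Lemma hf_mem_vertices (P : pred V) (x : V) : hf_mem (hf_nat x) (hf_vertices P) = P x.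
Proof.
rewrite /hf_vertices hf_mem_set.
rewrite (mem_map (inj_comp hf_nat_inj (@ord_inj _))) mem_enum.
by [].
Qed.

Lemma hf_mem_relation (R : rel V) (x y : V) :
  hf_mem (hf_pair (hf_nat x) (hf_nat y)) (hf_relation R) = R x y.
Proof.
rewrite /hf_relation hf_mem_set; apply/mapP/idP => [[[x' y']]|Rxy].
  rewrite mem_filter /= => /andP[R' _] /hf_pair_inj[/hf_nat_inj/ord_inj-> ].
  by move=> /hf_nat_inj/ord_inj->.
by exists (x, y) => //; rewrite mem_filter /= Rxy mem_enum.
Qed.

(** A von Neumann ordinal is the set of the smaller ones, so the vertex set is itself the ordinal
    [m], and the size can be read off it. *)
Lemma code_verticesE : code_vertices w = hf_nat m.
Proof.
rewrite /code_vertices /input_code /= !hf_fstE; apply: hf_ext => u.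
rewrite hf_mem_nat /hf_vertices hf_mem_set; congr (_ \in _).
rewrite enumT -[Finite.enum _]enumT /=.
by rewrite (map_comp hf_nat val) val_enum_ord.
Qed.

Lemma code_sizeE : code_size w = m.
Proof.
rewrite /code_size code_verticesE.
have lt_m : bmin (hf_nat m).+1 (fun x => hf_nat x == hf_nat m) < (hf_nat m).+1.
  by apply/bmin_ltP; exists m; rewrite ?ltnS ?leq_hf_nat.
exact: hf_nat_inj (eqP (bminP lt_m)).
Qed.

Lemma code_adjE (x y : V) : code_adj w x y = can_adj x y.
Proof.
by rewrite /code_adj /code_edges /input_code /= hf_fstE hf_sndE hf_mem_relation.
Qed.

Lemma code_partE (i : 'I_s.+1) :
  code_part i w = hf_vertices (fun x : V => can_part x == i).
Proof.
rewrite /code_part /input_code hf_tuple_fst /=; last first.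
  by rewrite size_rcons size_map size_enum_ord !ltnS leq_ord.
rewrite nth_rcons size_map size_enum_ord ltn_ord (nth_map ord0) ?size_enum_ord //.
by rewrite nth_ord_enum.
Qed.

Lemma code_targetE : code_target w = hf_vertices (@can_target s J).
Proof.
rewrite /code_target /input_code; set l := _ :: rcons _ _.
have -> : s.+3 = size l by rewrite /= size_rcons size_map size_enum_ord.
by rewrite hf_tuple_last /= last_rcons.
Qed.

Lemma code_lowE j (x : V) : j <= s.+1 -> code_low j w x = (can_part x < j).
Proof.
elim: j => // j IHj lt_j; rewrite /= IHj ?(ltnW lt_j) // (code_partE (Ordinal lt_j)).
by rewrite hf_mem_vertices ltnS [RHS]leq_eqVlt orbC -val_eqE.
Qed.

Lemma code_nearP j d (x : V) : j <= s.+1 ->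
  code_near j d w x <-> near (low (@can_part s J : H -> _) j) d x.
Proof.
move=> le_j; elim: d x => [|d IHd] x.
  rewrite /= code_lowE //; split=> [lt_x|[y + <-//]].
  by exists x.
rewrite nearS /=; split.
  move=> /orP[/IHd|/exbP[z]]; first by left.
  rewrite code_sizeE => lt_z /andP[]; rewrite -[z]/(val (Ordinal lt_z)).
  by move=> /IHd nz; rewrite code_adjE => zx; right; exists (Ordinal lt_z).
move=> [/IHd->//|[z /IHd nz zx]]; apply/orP; right; apply/exbP; exists (val z).
  by rewrite code_sizeE /= ltn_ord.
by rewrite nz code_adjE.
Qed.

Lemma code_validP j a' a : j <= s ->
  code_valid j w a' a <-> valid k (@can_part s J : H -> _) j
    (fun x : V => digit b a' x) (fun x : V => digit b a x).
Proof.
move=> le_j; have nJ d x := @code_nearP j d x (leqW le_j).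
have nS d x := @code_nearP j.+1 d x le_j.
rewrite /code_valid code_sizeE; split=> [/allbP va|va].
  have {}va (x : V) := va x (ltn_ord x).
  split=> [x|x|x|x y xy].
  - by move=> /nJ nx; case/and4P: (va x) => /implyP/(_ nx)/eqP.
  - by move=> /nS nx; case/and4P: (va x) => _ /implyP/(_ nx).
  - move=> nx; case/and4P: (va x) => _ _ /implyP va3 _; apply/eqP/va3.
    by apply/negP => /nS.
  - move=> eq_c; case/and4P: (va x) => _ _ _ /allbP/(_ y (ltn_ord y)).
    by rewrite code_adjE => /implyP/(_ xy); rewrite eq_c eqxx => /eqP.
case: va => old rng out prop; apply/allbP => i lt_i.
rewrite -[i]/(val (Ordinal lt_i)); set x := Ordinal lt_i; apply/and4P; split.
- by apply/implyP => /nJ nx; apply/eqP/old.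
- by apply/implyP => /nS nx; apply/rng.
- by apply/implyP => /negP nx; apply/eqP/out => /nS.
apply/allbP => i' lt_i'; rewrite -[i']/(val (Ordinal lt_i')) code_adjE.
by apply/implyP => xy; apply/implyP => /eqP eq_c; apply/eqP/(prop _ _ xy).
Qed.

Lemma digits_ex (c : V -> nat) : (forall x, c x < b) ->
  exists2 a, a < b ^ m & forall x : V, digit b a x = c x.
Proof.
move=> cb; pose d i := if insub i is Some x then c x else 0.
have dE (x : V) : d x = c x by rewrite /d valK.
have db i : i < m -> d i < b.
  by move=> lt_i; rewrite -[i]/(val (Ordinal lt_i)) dE.
exists (undigit b m d); first exact: undigit_lt.
by move=> x; rewrite digit_undigit.
Qed.

(** Makes the search below [b ^ m] exhaustive: if it fails, no valid coloring exists, and [step]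
    takes its default as well. *)
Lemma valid_lt j c' c : j <= s -> valid k (@can_part s J : H -> _) j c' c ->
  forall x, c x < b.
Proof.
move=> le_j [_ rng out _] x.
have [/rng/andP[_ le_c]|/out->//] :=
  pselect (near (low (@can_part s J : H -> _) j.+1) (rad k s j) x).
by rewrite ltnS (leq_trans le_c) // leq_add2l.
Qed.

Lemma code_colE j : j <= s.+1 ->
  col k (@input_lt s H) (@input_part s H) j = (fun x : V => digit b (code_col j w) x).
Proof.
elim: j => [_|j IHj le_j]; first by apply: funext => x; rewrite /digit div0n mod0n.
have finH := input_finite H; have linH := input_linear H.
have {}IHj := IHj (ltnW le_j); rewrite /= code_sizeE IHj.
set a' := code_col j w; set P := code_valid j w a'; set a := bmin _ P.
have vP := @code_validP j a' _ le_j.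
have [lt_a|le_a] := ltnP a (b ^ m); last first.
  have aE : a = b ^ m by apply/eqP; rewrite eqn_leq le_a bmin_le.
  rewrite step0; first by apply: funext => x; rewrite aE -[b ^ m]mul1n -[1 * _]add0n
    digit_addl // /digit div0n mod0n.
  move=> [c [vc _]]; have [a1 lt_a1 a1E] := digits_ex (valid_lt le_j vc).
  have Pa1 : P a1 by apply/vP; rewrite (funext a1E).
  by have := bmin_min lt_a1 Pa1; rewrite -/a aE leqNgt lt_a1.
have Pa : P a by apply: bminP.
(* A lexicographically smaller valid coloring would have a smaller code, which the search would have
   found first. *)
have mina : lexmin (@input_lt s H) (valid k (@input_part s H) j
    (fun x : V => digit b a' x)) (fun x : V => digit b a x).
  split; first exact/vP.
  move=> d vd [v [lt_v eq_v]].
  have [a1 lt_a1 a1E] := digits_ex (valid_lt le_j vd).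
  have Pa1 : P a1 by apply/vP; rewrite (funext a1E).
  have := bmin_min lt_a1 Pa1; rewrite -/a leqNgt => /negP; apply.
  rewrite -(undigit_digit _ lt_a1) // -[X in _ < X](undigit_digit _ lt_a) //.
  apply: (@undigit_lex b _ m _ _ v) => // [i _||i lt_i lt_im].
  - by rewrite ltn_mod.
  - by rewrite a1E.
  - by rewrite -[i]/(val (Ordinal lt_im)) a1E eq_v.
apply: (lexmin_uniq linH finH _ mina); apply: stepP; eexists; exact: mina.
Qed.

Lemma code_outputE : code_output w = output_code J (perfect_algorithm k s).
Proof.
apply: hf_ext => u; rewrite /output_code hf_mem_set.
pose out x := hf_pair (hf_nat x) (hf_nat (digit b (code_col s.+1 w) x).-1).
have colE (x : V) : digit b (code_col s.+1 w) x =
    col k (@input_lt s H) (@input_part s H) s.+1 x by rewrite code_colE.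
have -> : hf_mem u (code_output w) =
    has (fun x => hf_mem (hf_nat x) (code_target w) && (u == out x)) (iota 0 m).
  rewrite /code_output code_sizeE; elim: m => [|n IHn]; first by rewrite /hf_mem div0n.
  rewrite -[X in iota 0 X]addn1 iotaD has_cat /= orbF -IHn add0n.
  by case: ifP => _; rewrite ?orbF // hf_mem_insert orbC.
apply/hasP/mapP => [[i]|[[x tx] _ ->]].
  rewrite mem_iota /= => lt_i; rewrite -[i]/(val (Ordinal lt_i)) code_targetE.
  rewrite hf_mem_vertices => /andP[tx /eqP->].
  exists (exist _ (Ordinal lt_i) tx); first by rewrite mem_enum.
  by rewrite /out colE.
exists (val x); first by rewrite mem_iota /= ltn_ord.
by rewrite code_targetE hf_mem_vertices tx /out colE eqxx.
Qed.

End Correct.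

Lemma perfect_algorithm_computable : computable (perfect_algorithm k s).
Proof.
exists code_output; last exact: code_outputE.
apply: recursive_ext (rec_code_output 1) => v.
by case/tupleP: v => x v; rewrite theadE.
Qed.

End Decode.

Theorem theorem3p5 (k s : nat) : ASI_c s (perfect_coloring_problem k s).
Proof.
exists (perfect_algorithm k s), (run_range s), (run_scale k s); split.
  exact: perfect_algorithm_computable.
exact: run_on_proper.
Qed.
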